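(* Let $\boldsymbol{k}=(k_1,\ldots,k_r)$ be a non-empty index with $\mathrm{wt}(\boldsymbol{k})=k$. Then the following equality holds in $\mathfrak{H}^1[[t]]$: $$w^{\star}_{\mathrm{CSF},\widehat{\mathcal{S}}}(\boldsymbol{k})=w^\star_{\mathrm{CSF}}(\boldsymbol{k})+(-1)^{k+1}\sum_{\boldsymbol{l}=(l_1,\ldots,l_r)\in\mathbb{Z}^r_{\ge0}}\ \prod_{j=1}^r\binom{k_j+l_j-1}{l_j}\,w^{\star}_{\mathrm{CSF}}(\overline{\boldsymbol{k}+\boldsymbol{l}})\,t^{l_1+\cdots+l_r},$$ where $\overline{\boldsymbol{k}+\boldsymbol{l}}=(k_r+l_r,\ldots,k_1+l_1)$.
   Context: An index is a tuple $\boldsymbol{k}=(k_1,\dots,k_r)$ of positive integers ($r\ge0$; $r=0$ is the empty index $\varnothing$); $\mathrm{wt}(\boldsymbol{k})=k_1+\cdots+k_r$. Let $\mathfrak{H}=\mathbb{Q}\langle x,y\rangle$ and $\mathfrak{H}^1=\mathbb{Q}+y\mathfrak{H}$. The shuffle product $\mathrm{sh}$ on $\mathfrak{H}$ (extended $t$-linearly and coefficientwise to $\mathfrak{H}[[t]]$) is the $\mathbb{Q}$-bilinear product with $w\,\mathrm{sh}\,1=1\,\mathrm{sh}\,w=w$ and $w_1u_1\,\mathrm{sh}\,w_2u_2=(w_1\,\mathrm{sh}\,w_2u_2)u_1+(w_1u_1\,\mathrm{sh}\,w_2)u_2$ for $u_1,u_2\in\{x,y\}$. Empty sums are $0$; for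 $i=r$ the string $k_{i+1},\dots,k_r$ is empty, and for $i=1$ the string $k_1,\dots,k_{i-1}$ is empty. A 2-poset is a finite poset $X$ with a label map $\delta_X:X\to\{x,y\}$. Put $W(X)=\sum_f \delta_X(f^{-1}(1))\cdots\delta_X(f^{-1}(\#X))\in\mathfrak{H}$, summed over all bijections $f:X\to\{1,\dots,\#X\}$ such that $p<q$ implies $f(p)<f(q)$ ($W(\varnothing)=1$). For $\boldsymbol{k}=(k_1,\dots,k_r)$, let $X^\star(\boldsymbol{k})$ be the 2-poset with elements $p_{i,m}$ ($1\le i\le r$, $1\le m\le k_i$), with order generated by $p_{i,1}<p_{i,2}<\cdots<p_{i,k_i}$ for each $i$ and $p_{i,1}<p_{i+1,k_{i+1}}$ for $1\le i\le r-1$, and with $p_{i,1}$ labelled $y$ and $p_{i,m}$ ($m\ge2$) labelled $x$. Put $w^\star(\boldsymbol{k})=W(X^\star(\boldsymbol{k}))\in\mathfrak{H}^1$, and $$w^\star_{\widehat{\mathcal{S}}}(\boldsymbol{k})=\sum_{i=0}^{r}(-1)^{k_{i+1}+\cdots+k_r}\,w^{\star}(k_1,\ldots,k_i)\ \mathrm{sh}\sum_{l_{i+1},\ldots,l_r\ge0}\ \prod_{j=i+1}^r\binom{k_j+l_j-1}{l_j}\,w^{\star}(k_r+l_r,\ldots,k_{i+1}+l_{i+1})\,t^{l_{i+1}+\cdots+l_r}\in\mathfrak{H}^1[[t]].$$ For a non-empty index $\boldsymbol{k}=(k_1,\dots,k_r)$ of weight $k$ set \begin{align*} w^{\star}_{\mathrm{CSF}}(\boldsymbol{k})&=\sum_{i=1}^r\sum_{j=0}^{k_i-2}w^{\star}(j+1,k_{i+1},\ldots,k_r,k_1,\ldots,k_{i-1},k_i-j)-k\,w^{\star}(k+1),\\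 w^{\star}_{\mathrm{CSF},\widehat{\mathcal{S}}}(\boldsymbol{k})&=\sum_{i=1}^r\sum_{j=0}^{k_i-2}w^{\star}_{\widehat{\mathcal{S}}}(j+1,k_{i+1},\ldots,k_r,k_1,\ldots,k_{i-1},k_i-j)\\ &\quad-\sum_{i=1}^r\sum_{j=0}^\infty w^{\star}_{\widehat{\mathcal{S}}}(j+1,k_{i+1},\ldots,k_r,k_1,\ldots,k_i)\,t^j-k\,w^{\star}_{\widehat{\mathcal{S}}}(k+1). \end{align*} *)

(* Defs.v *)
From HB Require Import structures.
From mathcomp Require Import all_boot all_order all_algebra.
From mathcomp Require Import finmap monalg.

Set Implicit Arguments.
Unset Strict Implicit.
Unset Printing Implicit Defensive.

Import Order.TTheory GRing.Theory.
Local Open Scope ring_scope.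

(* Q<x,y>, as the monoid algebra over rat of the free monoid on two letters:  *)
(* the ring product is concatenation of words.                                *)
Definition letter : choiceType := bool.
Definition lx : letter := false.
Definition ly : letter := true.

Definition H := {malg rat[{fmonom letter}]}.

Definition word (s : seq letter) : H := << FMonom s >>.
Definition let_ (a : letter) : H := word [:: a].

Definition in_H1 (w : H) : Prop :=
  exists (c : rat) (h : H), w = c%:MP + let_ ly * h.

(* The shuffle recursion peels off last letters, so words are read backwards. *)
Fixpoint sh_rev (p : seq letter) : seq letter -> H :=
  fix sh_rev_p (q : seq letter) : H :=
    match p, q with
    | [::], _ => word (rev q)
    | _, [::] => word (rev p)
    | a :: p', b :: q' => sh_rev p' q * let_ a + sh_rev_p q' * let_ b
    end.

Definition sh_word (u v : seq letter) : H := sh_rev (rev u) (rev v).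

Definition sh (f g : H) : H :=
  \sum_(u <- msupp f) \sum_(v <- msupp g) (f@_u * g@_v) *: sh_word u v.

Lemma sh_word_nil_l v : sh_word [::] v = word v.
Proof. by rewrite /sh_word /=; case: (rev v) (revK v) => [|a s] /= ->. Qed.

Lemma sh_word_nil_r u : sh_word u [::] = word u.
Proof. by rewrite /sh_word /=; case: (rev u) (revK u) => [|a s] /= ->. Qed.

Lemma sh_word_rcons u a v b :
  sh_word (rcons u a) (rcons v b) =
    sh_word u (rcons v b) * let_ a + sh_word (rcons u a) v * let_ b.
Proof. by rewrite /sh_word !rev_rcons. Qed.

Lemma sh_wordE u v : sh (word u) (word v) = sh_word u v.
Proof.
by rewrite /sh /word !msuppU1 !big_seq_fset1 !mcoeffUU mulr1 scale1r.
Qed.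

(* H[[t]]: a series is the sequence of its coefficients.                      *)
Definition series := nat -> H.

Definition cst (w : H) : series := fun n => if n == 0%N then w else 0.

Definition sht (f g : series) : series :=
  fun n => \sum_(i < n.+1) sh (f i) (g (n - i)%N).

(* The series \sum_(j >= 0) f_j t^j, for f_j in H[[t]].                       *)
Definition sum_t (f : nat -> series) : series :=
  fun n => \sum_(j < n.+1) f j (n - j)%N.

(* The series \sum_l f(l) t^(l_1 + ... + l_s), l ranging over tuples of s     *)
(* natural numbers: the coefficient of t^n collects the finitely many l with  *)
(* l_1 + ... + l_s = n, all of whose entries are at most n.                   *)
Definition sum_tl (s : nat) (f : seq nat -> H) : series :=
  fun n => \sum_(l : s.-tuple 'I_n.+1 | sumn (map val l) == n) f (map val l).

(* W(X) for a 2-poset (X, delta). An injective f : X -> 'I_#|X| is bijective, *)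
(* positions being numbered from 0; the inner product has exactly one factor, *)
(* delta (f^-1 i).                                                            *)
Definition linear_ext (d : Order.disp_t) (X : finPOrderType d)
    (f : {ffun X -> 'I_#|X|}) : bool :=
  injectiveb f && [forall p, forall q, (p < q)%O ==> (f p < f q)%N].

Definition W (d : Order.disp_t) (X : finPOrderType d)
    (delta : X -> letter) : H :=
  \sum_(f : {ffun X -> 'I_#|X|} | linear_ext f)
    \prod_(i < #|X|) \prod_(p | f p == i) let_ (delta p).

(* The 2-poset X^*(k). Both subscripts are shifted to start from 0: the       *)
(* element p_{i,m} is Tagged _ m' : Xstar k with tag i-1 and m' = m-1.        *)
Definition Xstar (k : seq nat) := {i : 'I_(size k) & 'I_(nth 0%N k i)}.

HB.instance Definition _ k := Finite.on (Xstar k).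

Definition Xstar_gen (k : seq nat) : rel (Xstar k) := fun p q =>
     (tag q == tag p :> nat) && (tagged q == (tagged p).+1 :> nat)
  || [&& tagged p == 0%N :> nat, tag q == (tag p).+1 :> nat
       & (tagged q).+1 == nth 0%N k (tag q)].

Definition Xstar_le (k : seq nat) : rel (Xstar k) := connect (@Xstar_gen k).

Lemma Xstar_le_refl k : reflexive (@Xstar_le k).
Proof. exact: connect0. Qed.

Lemma Xstar_le_trans k : transitive (@Xstar_le k).
Proof. exact: connect_trans. Qed.

Lemma Xstar_le_lex k (p q : Xstar k) : Xstar_le p q ->
  (tag p < tag q)%N || (tag p == tag q :> nat) && (tagged p <= tagged q)%N.
Proof.
case/connectP=> s; elim: s p => [|r s IHs] p /=.
  by move=> _ ->; rewrite eqxx leqnn orbT.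
case/andP=> gen_pr /IHs{}IHs /IHs{IHs}.
move: (tagged q : nat) => mq; move: (tag q : nat) => iq.
case/orP: gen_pr => [|/and3P[_ + _]].
  move: (tagged r : nat) => mr; move: (tagged p : nat) => mp.
  move: (tag r : nat) => ir.
  by case/andP=> /eqP-> /eqP-> /orP[->//|/andP[-> /ltnW->]]; rewrite orbT.
move: (tagged r : nat) => mr; move: (tag r : nat) => ir /eqP->.
by case/orP=> [/ltnW ->//|/andP[/eqP <- _]]; rewrite leqnn.
Qed.

Lemma Xstar_le_anti k : antisymmetric (@Xstar_le k).
Proof.
move=> p q /andP[/Xstar_le_lex pq /Xstar_le_lex qp].
have [eq_i eq_m] : tag p = tag q :> nat /\ tagged p = tagged q :> nat.
  move: pq qp; move: (tagged p : nat) (tagged q : nat) => mp mq.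
  case: (ltngtP (tag p) (tag q)) => //= ->.
  by move=> le_pq le_qp; split=> //; apply/eqP; rewrite eqn_leq le_pq.
case: p q eq_i eq_m {pq qp} => [i a] [j b] /= /val_inj eq_ij.
by case: j / eq_ij b => b /val_inj ->.
Qed.

Fact Xstar_display : Order.disp_t. Proof. exact: Order.Disp tt tt. Qed.

HB.instance Definition _ k := Order.Le_isPOrder.Build Xstar_display (Xstar k)
  (@Xstar_le_refl k) (@Xstar_le_anti k) (@Xstar_le_trans k).

Definition Xstar_label (k : seq nat) (p : Xstar k) : letter :=
  if tagged p == 0%N :> nat then ly else lx.

Definition wstar (k : seq nat) : H := W (@Xstar_label k).

(* An index is a sequence of positive integers, k_1 being nth 0 k 0.          *)
Definition is_index (k : seq nat) : bool := all (fun a => 0 < a)%N k.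

Definition add_index (k l : seq nat) : seq nat :=
  [seq (a.1 + a.2)%N | a <- zip k l].

Definition binom_index (k l : seq nat) : nat :=
  \prod_(a <- zip k l) 'C(a.1 + a.2 - 1, a.2).

(* The sum over l of \prod_j C(k_j + l_j - 1, l_j) w(rev (k + l)) t^(\sum l). *)
Definition shift_sum (w : seq nat -> H) (k : seq nat) : series :=
  sum_tl (size k) (fun l => (binom_index k l)%:R *: w (rev (add_index k l))).

Definition wstarS (k : seq nat) : series := fun n =>
  \sum_(i < (size k).+1) (-1) ^+ sumn (drop i k) *:
    sht (cst (wstar (take i k))) (shift_sum wstar (drop i k)) n.

(* (j+1, k_{i+1}, ..., k_r, k_1, ..., k_{i-1}, k_i - j), with i shifted by 1. *)
Definition csf_index (k : seq nat) (i j : nat) : seq nat :=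
  j.+1 :: drop i.+1 k ++ take i k ++ [:: (nth 0 k i - j)%N].

Definition wCSF (k : seq nat) : H :=
  \sum_(i < size k) \sum_(j < (nth 0 k i).-1) wstar (csf_index k i j)
  - (sumn k)%:R *: wstar [:: (sumn k).+1].

Definition wCSFS (k : seq nat) : series := fun n =>
  \sum_(i < size k) \sum_(j < (nth 0%N k i).-1) wstarS (csf_index k i j) n
  - \sum_(i < size k)
      sum_t (fun j => wstarS (j.+1 :: drop i.+1 k ++ take i.+1 k)) n
  - (sumn k)%:R *: wstarS [:: (sumn k).+1] n.

(* Main.v *)
(* With X and Y the right multiplications by the letters x and y, the shuffle
   product makes H commutative, and L f sh M g = L (f sh M g) + M (L f sh g) for
   L, M in {X, Y}.  Write z(k_1, ..., k_r) for the word y x^(k_r - 1) ... y x^(k_1 - 1).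
   Cutting the zigzag X^*(k) after each of its chains gives
     \sum_b (-1)^b z(k_1, ..., k_b) sh w^*(k_(b+1), ..., k_r) = 0,
   an equation inherited by the binomial shifts E of w^*.  It reduces the products
   w^*(j+1, M) sh E(a-j, N) occurring in the middle cuts of w^*_S to products of
   words in which the chains of lengths j+1 and a-j come last; comparing the top
   letters of these two chains makes the alternating sum over j telescope.  Each of
   the sums over j then splits into a common part and a term B(M, N), the words of
   the poset in which a new chain has its bottom below the first tops of M and N.  The common
   parts cancel and the B(M, N) telescope along the cuts of the cyclically rotated
   index; what they leave at the ends is absorbed by the uncut and the fully cut
   terms, which are matched by Vandermonde's identity. *)
Require Import Defs.
From HB Require Import structures.
From mathcomp Require Import all_boot all_order all_algebra.
From mathcomp Require Import finmap monalg.
From mathcomp Require Import ring zify.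
From mathcomp Require boolp.
Import GRing.Theory.
Local Open Scope ring_scope.

Set Implicit Arguments.
Unset Strict Implicit.
Unset Printing Implicit Defensive.

(** * Binomial identities and formal power series *)

Lemma sum_triangle (U : nmodType) n (F : nat -> nat -> U) :
  \sum_(i < n.+1) \sum_(j < (n - i).+1) F i j =
    \sum_(m < n.+1) \sum_(i < m.+1) F i (m - i)%N.
Proof.
elim: n => [|n IHn]; first by rewrite !big_ord1.
rewrite big_ord_recr [RHS]big_ord_recr /= -IHn subnn big_ord1.
rewrite [\sum_(i < n.+2) _]big_ord_recr /= subnn addrA; congr (_ + _).
rewrite -big_split /=; apply: eq_bigr => i _.
by rewrite (subSn (ltn_ord i : (i <= n)%N)) big_ord_recr.
Qed.

(** Both sides are the coefficient of t^n in (1 - t)^(-a-1) (1 - t)^(-b-1). The proof is a double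
    induction on [a] and [n] by Pascal's rule. *)
Lemma Vandermonde_upper a b n :
  (\sum_(i < n.+1) 'C(a + i, i) * 'C(b + (n - i), n - i) = 'C((a + b).+1 + n, n))%N.
Proof.
elim: a n => [|a IHa] n.
  elim: n => [|n IHn]; first by rewrite big_ord1 !bin0.
  rewrite big_ord_recl bin0 mul1n subn0 add0n addSn binS; congr (_ + _)%N.
  rewrite addnS -addSn -IHn; apply: eq_bigr => i _.
  by rewrite /bump /= !add0n !binn subSS.
elim: n => [|n IHn]; first by rewrite big_ord1 !bin0.
rewrite !addSn binS -addSn -{1}(addSn a b) [(_ + n.+1)%N in X in (_ + X)%N]addnS.
rewrite -addSn -IHn -IHa.
rewrite big_ord_recl [in X in _ = (X + _)%N]big_ord_recl /= !bin0 -addnA; congr (_ + _)%N.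
rewrite -big_split /=; apply: eq_bigr => i _; rewrite /bump /= subSS.
by rewrite -mulnDl !addSn addnS binS.
Qed.

Lemma alternating_binomial_sum (R : pzRingType) n :
  \sum_(j < n.+1) (-1) ^+ j *+ 'C(n, n - j) = (n == 0)%:R :> R.
Proof.
transitivity (((1 : R) + (-1)) ^+ n); last by rewrite subrr expr0n.
rewrite exprDn_comm; last by rewrite /GRing.comm mulrN1 mulN1r.
apply: eq_bigr => j _.
by rewrite expr1n mul1r bin_sub // -ltnS.
Qed.

(* Vandermonde: a monotone lattice path from (0, 0) to (n, m) meets each of the
   n + m + 1 antidiagonals exactly once. *)
Lemma lattice_path_sum (U : nmodType) n m (g : nat -> U) :
  \sum_(i < n.+1) \sum_(l < m.+1)
      g (i + l)%N *+ ('C(i + l, l) * 'C(n - i + (m - l), m - l)) =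
    \sum_(j < (n + m).+1) g j *+ 'C(n + m, m).
Proof.
transitivity (\sum_(l < m.+1) \sum_(j < (n + m).+1)
    g j *+ ('C(j, l) * 'C(n + m - j, m - l))); last first.
  rewrite exchange_big; apply: eq_bigr => j _ /=.
  by rewrite sumrMnr binomial.Vandermonde subnKC // -ltnS.
rewrite exchange_big; apply: eq_bigr => l _ /=.
have lem : (l <= m)%N := ltn_ord l; symmetry.
(* For fixed [l] the antidiagonals are j = i + l. Those with j < l or j > n + l contribute nothing,
   because one of the two binomials vanishes there. *)
rewrite -(big_mkord predT (fun j => g j *+ ('C(j, l) * 'C(n + m - j, m - l)))).
rewrite (@big_cat_nat _ _ _ l) //=; last by lia.
rewrite [X in X + _]big_nat [X in X + _] big1 ?add0r => [|j ltj]; last first.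
  by rewrite bin_small.
rewrite (@big_cat_nat _ _ _ (n.+1 + l)%N) //=; try lia.
rewrite [X in _ + X]big_nat [X in _ + X]big1 ?addr0 => [|j /andP[lej ltj]]; last first.
  by rewrite [X in (_ * X)%N]bin_small ?muln0 //; lia.
rewrite -{1}[l : nat]add0n big_addn addnK big_mkord; apply: eq_bigr => i _.
have := ltn_ord i => lti.
by congr (g _ *+ (_ * 'C(_, _))%N); lia.
Qed.

(** * The ring of formal power series *)

Section PowerSeries.
Variable A : comNzRingType.

(** Equality of coefficient functions is undecidable, so the equality and choice structures below a
    ring structure are taken classically. *)
Record fps := Fps { coefs : nat -> A }.

HB.instance Definition _ := boolp.gen_eqMixin fps.
HB.instance Definition _ := boolp.gen_choiceMixin fps.

Implicit Types (f g h : fps) (F G : nat -> fps).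

Lemma fpsP f g : (forall n, coefs f n = coefs g n) -> f = g.
Proof. by case: f g => [f] [g] /= /boolp.funext ->. Qed.

Fact fps_addA : associative (fun f g => Fps (fun n => coefs f n + coefs g n)).
Proof. by move=> f g h; apply: fpsP => n /=; rewrite addrA. Qed.
Fact fps_addC : commutative (fun f g => Fps (fun n => coefs f n + coefs g n)).
Proof. by move=> f g; apply: fpsP => n /=; rewrite addrC. Qed.
Fact fps_add0 :
  left_id (Fps (fun=> 0)) (fun f g => Fps (fun n => coefs f n + coefs g n)).
Proof. by move=> f; apply: fpsP => n /=; rewrite add0r. Qed.
Fact fps_addN : left_inverse (Fps (fun=> 0)) (fun f => Fps (fun n => - coefs f n))
  (fun f g => Fps (fun n => coefs f n + coefs g n)).
Proof. by move=> f; apply: fpsP => n /=; rewrite addNr. Qed.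

HB.instance Definition _ :=
  GRing.isZmodule.Build fps fps_addA fps_addC fps_add0 fps_addN.

Definition fps_mul f g :=
  Fps (fun n => \sum_(i < n.+1) coefs f i * coefs g (n - i)%N).

Definition fpsC (a : A) := Fps (fun n => if n == 0%N then a else 0).

Definition fps_trunc N f : {poly A} := \poly_(i < N) coefs f i.

(** A coefficient of a product depends on finitely many coefficients of the factors. Associativity
    and commutativity can therefore be read off in the polynomial ring. *)
Lemma coefs_mul_poly N n f g : (n < N)%N ->
  coefs (fps_mul f g) n = (fps_trunc N f * fps_trunc N g)`_n.
Proof.
move=> ltnN; rewrite coefM; apply: eq_bigr => i _.
by rewrite !coef_poly !ifT //; have := ltn_ord i; lia.
Qed.

Fact fps_mulA : associative fps_mul.
Proof.
move=> f g h; apply: fpsP => n.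
transitivity ((fps_trunc n.+1 f * (fps_trunc n.+1 g * fps_trunc n.+1 h))`_n).
  rewrite coefM; apply: eq_bigr => i _; rewrite -coefs_mul_poly; last by lia.
  by rewrite coef_poly ltn_ord.
rewrite mulrA coefM; apply: eq_bigr => i _; rewrite -coefs_mul_poly //.
by rewrite coef_poly ifT //; lia.
Qed.

Fact fps_mulC : commutative fps_mul.
Proof.
by move=> f g; apply: fpsP => n; rewrite !(@coefs_mul_poly n.+1) // mulrC.
Qed.

Fact fps_mul1 : left_id (fpsC 1) fps_mul.
Proof.
move=> f; apply: fpsP => n /=; rewrite big_ord_recl /= mul1r subn0 big1 ?addr0 //.
by move=> i _; rewrite mul0r.
Qed.

Fact fps_mulDl : left_distributive fps_mul +%R.
Proof.
move=> f g h; apply: fpsP => n /=; rewrite -big_split /=.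
by apply: eq_bigr => i _; rewrite mulrDl.
Qed.

Fact fps_one_neq0 : fpsC 1 != 0.
Proof. by apply/eqP => /(congr1 (coefs^~ 0)) /= /eqP; rewrite oner_eq0. Qed.

HB.instance Definition _ := GRing.Zmodule_isComNzRing.Build fps
  fps_mulA fps_mulC fps_mul1 fps_mulDl fps_one_neq0.

Definition coef_at n f := coefs f n.
Fact coef_at_additive n : zmod_morphism (coef_at n). Proof. by []. Qed.
HB.instance Definition _ n :=
  GRing.isZmodMorphism.Build fps A (coef_at n) (coef_at_additive n).

Lemma coefs_sum (I : Type) (r : seq I) (P : pred I) (F : I -> fps) n :
  coefs (\sum_(i <- r | P i) F i) n = \sum_(i <- r | P i) coefs (F i) n.
Proof. exact: (raddf_sum (coef_at n)). Qed.

Lemma coefsD f g n : coefs (f + g) n = coefs f n + coefs g n.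
Proof. by []. Qed.

Lemma coefsMn f n m : coefs (f *+ n) m = coefs f m *+ n.
Proof. exact: (raddfMn (coef_at m)). Qed.

Lemma coefs_sign f k n : coefs ((-1) ^+ k * f) n = (-1) ^+ k * coefs f n.
Proof. exact: (raddfMsign (coef_at n)). Qed.

Lemma coefsM f g n : coefs (f * g) n = \sum_(i < n.+1) coefs f i * coefs g (n - i)%N.
Proof. by []. Qed.

Fact fpsC_additive : zmod_morphism fpsC.
Proof. by move=> a b; apply: fpsP => -[|n] //=; rewrite subr0. Qed.
HB.instance Definition _ := GRing.isZmodMorphism.Build A fps fpsC fpsC_additive.

Lemma coefsCM a f n : coefs (fpsC a * f) n = a * coefs f n.
Proof.
rewrite coefsM big_ord_recl subn0 big1 ?addr0 // => i _.
by rewrite mul0r.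
Qed.

Lemma fpsCM a b : fpsC (a * b) = fpsC a * fpsC b.
Proof. by apply: fpsP => n; rewrite coefsCM /=; case: eqP; rewrite ?mulr0. Qed.

Lemma fpsC1 : fpsC 1 = 1. Proof. by []. Qed.

Definition fpsX : fps := Fps (fun n => (n == 1%N)%:R).

Lemma coefsXM f n : coefs (fpsX * f) n = if n is m.+1 then coefs f m else 0.
Proof.
rewrite coefsM; case: n => [|n]; first by rewrite big_ord1 mul0r.
rewrite !big_ord_recl /= mul0r add0r mul1r subSS subn0 big1 ?addr0 // => i _.
by rewrite mul0r.
Qed.

Lemma coefsXnM k f n :
  coefs (fpsX ^+ k * f) n = if (k <= n)%N then coefs f (n - k) else 0.
Proof.
elim: k n => [|k IHk] n; first by rewrite mul1r subn0.
by rewrite exprS -mulrA coefsXM; case: n.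
Qed.

Definition fps_lift (L : A -> A) f := Fps (fun n => L (coefs f n)).

Fact fps_lift_additive (L : {additive A -> A}) : zmod_morphism (fps_lift L).
Proof. by move=> f g; apply: fpsP => n /=; rewrite raddfB. Qed.
HB.instance Definition _ (L : {additive A -> A}) :=
  GRing.isZmodMorphism.Build fps fps (fps_lift L) (fps_lift_additive L).

Lemma fps_lift_X (L : {additive A -> A}) f :
  fps_lift L (fpsX * f) = fpsX * fps_lift L f.
Proof.
apply: fpsP => n; rewrite coefsXM -[LHS]/(L (coefs (fpsX * f) n)) coefsXM.
by case: n; rewrite ?raddf0.
Qed.

Lemma fps_liftC (L : {additive A -> A}) a : fps_lift L (fpsC a) = fpsC (L a).
Proof. by apply: fpsP => -[|n] /=; rewrite ?raddf0. Qed.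

(** Coefficient n + 1 of [f] is [L] of coefficient n, and coefficient 0 vanishes. So 1 - tL is
    injective, and an equation f = h + t L(f) has at most one solution. *)
Lemma fpsX_lift_eq0 (L : {additive A -> A}) f : f = fpsX * fps_lift L f -> f = 0.
Proof.
move=> fE; apply: fpsP; elim=> [|n IHn]; rewrite fE coefsXM //.
by rewrite -[LHS]/(L (coefs f n)) IHn raddf0.
Qed.

Lemma fps_lift_mul (L M : {additive A -> A}) :
    (forall a b, L a * M b = L (a * M b) + M (L a * b)) ->
  forall f g, fps_lift L f * fps_lift M g =
    fps_lift L (f * fps_lift M g) + fps_lift M (fps_lift L f * g).
Proof.
move=> LM f g; apply: fpsP => n /=; rewrite !raddf_sum -big_split /=.
by apply: eq_bigr => i _; rewrite LM.
Qed.

(* The series \sum_(j >= 0) F j * t^j. *)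
Definition fps_sum F := Fps (fun n => \sum_(j < n.+1) coefs (F j) (n - j)).

Lemma coefs_fps_sum N F n : (n < N)%N ->
  coefs (fps_sum F) n = coefs (\sum_(j < N) fpsX ^+ j * F j) n.
Proof.
move=> ltnN; rewrite coefs_sum.
under eq_bigr => j _ do rewrite coefsXnM.
by rewrite -big_mkcond /= (big_ord_widen _ (fun j => coefs (F j) (n - j)%N) ltnN).
Qed.

Lemma eq_fps_sum F G : F =1 G -> fps_sum F = fps_sum G.
Proof. by move=> eqFG; apply: fpsP => n /=; apply: eq_bigr => j _; rewrite eqFG. Qed.

Lemma fps_sum_recl F : fps_sum F = F 0%N + fpsX * fps_sum (fun j => F j.+1).
Proof.
apply: fpsP => n; rewrite coefsD coefsXM /= big_ord_recl subn0; congr (_ + _).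
by case: n => [|n]; rewrite ?big_ord0.
Qed.

Lemma fps_sumB F G : fps_sum (fun j => F j - G j) = fps_sum F - fps_sum G.
Proof. by apply: fpsP => n /=; rewrite -sumrB. Qed.

Lemma fps_sumD F G : fps_sum (fun j => F j + G j) = fps_sum F + fps_sum G.
Proof. by apply: fpsP => n /=; rewrite -big_split. Qed.

Lemma fps_sum_sum (I : Type) (r : seq I) (P : pred I) (F : I -> nat -> fps) :
  fps_sum (fun j => \sum_(i <- r | P i) F i j) = \sum_(i <- r | P i) fps_sum (F i).
Proof.
apply: fpsP => n; rewrite coefs_sum /= exchange_big; apply: eq_bigr => j _ /=.
by rewrite coefs_sum.
Qed.

Lemma fps_sumMr F g : fps_sum (fun j => F j * g) = fps_sum F * g.
Proof.
apply: fpsP => n; rewrite (@coefs_fps_sum n.+1) //.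
under eq_bigr => j _ do rewrite mulrA.
rewrite -mulr_suml !coefsM; apply: eq_bigr => i _.
by rewrite -coefs_fps_sum.
Qed.

Lemma fps_sumMl F g : fps_sum (fun j => g * F j) = g * fps_sum F.
Proof. by rewrite mulrC -fps_sumMr; apply: eq_fps_sum => j; rewrite mulrC. Qed.

Lemma fps_lift_sum (L : {additive A -> A}) F :
  fps_lift L (fps_sum F) = fps_sum (fun j => fps_lift L (F j)).
Proof. by apply: fpsP => n /=; rewrite raddf_sum. Qed.

Lemma fps_sum2 (F : nat -> nat -> fps) :
  fps_sum (fun i => fps_sum (F i)) =
    fps_sum (fun m => \sum_(i < m.+1) F i (m - i)%N).
Proof.
apply: fpsP => n /=.
rewrite (sum_triangle n (fun i j => coefs (F i j) (n - i - j)%N)).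
apply: eq_bigr => m _; rewrite coefs_sum; apply: eq_bigr => i _.
by congr (coefs _ _); have := ltn_ord i; lia.
Qed.

Lemma fps_sum_exchange (F : nat -> nat -> fps) :
  fps_sum (fun i => fps_sum (F i)) = fps_sum (fun j => fps_sum (F^~ j)).
Proof.
rewrite !fps_sum2; apply: eq_fps_sum => m; rewrite (reindex_inj rev_ord_inj) /=.
by apply: eq_bigr => i _; rewrite subSS subKn // -ltnS.
Qed.

(** Collecting the terms with j + l = m leaves [g m] times the alternating sum of row m of Pascal's
    triangle, which is 0 unless m = 0. *)
Lemma fps_sum_alternating (g : nat -> fps) :
  fps_sum (fun j => (-1) ^+ j * fps_sum (fun l => g (j + l)%N *+ 'C(j + l, l))) = g 0%N.
Proof.
under eq_fps_sum => j do rewrite -fps_sumMl.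
rewrite fps_sum2 fps_sum_recl big_ord1 expr0 mul1r mulr1n -[RHS]addr0; congr (_ + _).
rewrite -[RHS](mulr0 fpsX); congr (_ * _); apply: fpsP => n /=; rewrite big1 // => m _.
suff -> : \sum_(i < m.+2) (-1) ^+ i *
      (g (i + (m.+1 - i))%N *+ 'C(i + (m.+1 - i), m.+1 - i)) =
    (\sum_(i < m.+2) (-1) ^+ i *+ 'C(m.+1, m.+1 - i)) * g m.+1.
  by rewrite alternating_binomial_sum mul0r.
rewrite mulr_suml; apply: eq_bigr => i _; rewrite subnKC; last by rewrite -ltnS.
by rewrite mulrnAr mulrnAl.
Qed.

End PowerSeries.

(** * Telescoping in a shuffle-like algebra *)

Section CyclicSumCore.
(** [X] and [Y] model appending the letters x and y; [V a v] models the binomial shift of a chain of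
    length [a] put on top of [v]. The recursions [V1E] and [VSE] express the geometric series and
    Pascal's rule. *)
Variables (S : comNzRingType) (X Y : {additive S -> S}) (t : S) (V : nat -> S -> S).
Hypothesis mulXX : forall f g, X f * X g = X (f * X g) + X (X f * g).
Hypothesis mulYX : forall f g, Y f * X g = Y (f * X g) + X (Y f * g).
Hypothesis mulYY : forall f g, Y f * Y g = Y (f * Y g) + Y (Y f * g).
Hypothesis Xt : forall f, X (t * f) = t * X f.
Hypothesis Yt : forall f, Y (t * f) = t * Y f.
Hypothesis tX_eq0 : forall f, f = t * X f -> f = 0.
Hypothesis V1E : forall v, V 1 v = Y v + t * X (V 1 v).
Hypothesis VSE : forall a v, V a.+2 v = X (V a.+1 v) + t * X (V a.+2 v).

Lemma tX_uniq f g h : f = h + t * X f -> g = h + t * X g -> f = g.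
Proof.
move=> fE gE; apply/eqP; rewrite -subr_eq0; apply/eqP/tX_eq0.
by rewrite {1}fE {1}gE raddfB mulrBr; ring.
Qed.

Lemma mulXY f g : X f * Y g = X (f * Y g) + Y (X f * g).
Proof. by rewrite mulrC mulYX addrC [Y g * f]mulrC [g * _]mulrC. Qed.

(** An unshifted chain of length j + 1 on top of [u], the counterpart of [V j.+1 u]. *)
Let c j u := iter j X (Y u).

(** The top letter of the product comes from one of the two chains. Since [V] equals its first
    recursive term only up to [t * X] of itself, a third term appears; the other part of that
    correction recombines with the first term into the full product with [V]. *)
Lemma top_split u v j m :
  c j u * V m.+1 v =
    (if j is i.+1 then X (c i u * V m.+1 v) else Y (u * V m.+1 v))
    + (if m is p.+1 then X (c j u * V m v) else Y (c j u * v))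
    + t * X (c j u * V m.+1 v).
Proof.
case: j m => [|j] [|m].
- rewrite /c /= [in LHS]V1E mulrDr mulrCA mulYX mulYY [in Y (u * V 1 v)]V1E.
  by rewrite [u * (_ + _)]mulrDr raddfD [u * (t * _)]mulrCA Yt; ring.
- rewrite /c /= [in LHS]VSE mulrDr mulrCA !mulYX [in Y (u * V m.+2 v)]VSE.
  by rewrite [u * (_ + _)]mulrDr raddfD [u * (t * _)]mulrCA Yt; ring.
- rewrite /c /= [in LHS]V1E mulrDr mulrCA mulXX mulXY.
  rewrite [in X (iter j _ _ * V 1 v)]V1E [iter j _ _ * (_ + _)]mulrDr raddfD.
  by rewrite [iter j _ _ * (t * _)]mulrCA Xt; ring.
rewrite /c /= [in LHS]VSE mulrDr mulrCA !mulXX.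
rewrite [in X (iter j _ _ * V m.+2 v)]VSE [iter j _ _ * (_ + _)]mulrDr raddfD.
by rewrite [iter j _ _ * (t * _)]mulrCA Xt; ring.
Qed.

(* Every summand is split according to the larger of the two top letters; the
   outcomes cancel in pairs along the sum, except at its two ends. *)
Lemma alternating_sum u v n :
  \sum_(j < n.+1) (-1) ^+ j * (c j u * V (n.+1 - j)%N v) =
    V 1 (u * V n.+1 v) + (-1) ^+ n * V 1 (c n u * v).
Proof.
(* Both sides solve f = h + t X(f) with this same [h], formed by the two summands that survive at
   the ends of the sum. *)
apply: (@tX_uniq _ _ (Y (u * V n.+1 v) + (-1) ^+ n * Y (c n u * v))); last first.
  rewrite raddfD raddfMsign /= [in LHS](V1E (u * _)) [in LHS](V1E (c n u * v)).
  by ring.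
rewrite raddf_sum mulr_sumr.
transitivity (\sum_(j < n.+1) ((-1) ^+ j *
     (if j : nat is i.+1 then X (c i u * V (n - i)%N v) else Y (u * V n.+1 v))
   + (-1) ^+ j *
     (if (n - j)%N is p.+1 then X (c j u * V (n - j)%N v) else Y (c j u * v)))
   + \sum_(j < n.+1) t * X ((-1) ^+ j * (c j u * V (n.+1 - j)%N v))).
  rewrite -big_split /=; apply: eq_bigr => j _.
  rewrite (subSn (ltn_ord j : (j <= n)%N)) [in LHS]top_split !mulrDr; congr (_ + _ + _).
    by case: j => [[|j] /= ltj] //; rewrite ?subn0 // subnSK.
  by rewrite mulrCA raddfMsign.
congr (_ + _); rewrite big_split /= big_ord_recl /= expr0 mul1r big_ord_recr /=.
rewrite subnn -!addrA; congr (_ + _); rewrite addrA -big_split /= big1 ?add0r //.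
move=> j _; rewrite /bump /= exprS -(subnSK (ltn_ord j)).
by rewrite mulN1r mulNr addNr.
Qed.

(** In the application [w] and [z] are the constant series of the star words and of the words of
    stacked chains, while [E] and [z'] are their binomial shifts. *)
Variables (w z E z' : seq nat -> S).
Hypotheses (z0 : z [::] = 1) (z'0 : z' [::] = 1).
Hypotheses (w0 : w [::] = 1) (E0 : E [::] = 1).
Hypothesis z_cons : forall a M, z (a.+1 :: M) = iter a X (Y (z M)).
Hypothesis z'_cons : forall a N, (0 < a)%N -> z' (a :: N) = V a (z' N).
Hypothesis w_rec : forall a M, is_index (a :: M) ->
  w (a :: M) = \sum_(b < (size M).+1) (-1) ^+ b * (z (a :: take b M) * w (drop b M)).
Hypothesis E_rec : forall a N, is_index (a :: N) ->
  E (a :: N) = \sum_(b < (size N).+1) (-1) ^+ b * (z' (a :: take b N) * E (drop b N)).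

(** Inclusion-exclusion over the cuts of [M] and [N]: [V 1] adds a new chain, and [f b d] holds the
    words forced below its bottom. *)
Definition slot_term (M N : seq nat) (f : nat -> nat -> S) : S :=
  \sum_(b < (size M).+1) \sum_(d < (size N).+1)
    (-1) ^+ b * (-1) ^+ d * V 1 (f b d) * w (drop b M) * E (drop d N).

(** This is B(M, N). In the two variants after it the new bottom lies instead above the top of a
    chain [a] placed before [N] or before [M]. *)
Definition bottoms_below M N :=
  slot_term M N (fun b d => z (take b M) * z' (take d N)).
Definition above_second M a N :=
  slot_term M N (fun b d => z (take b M) * z' (a :: take d N)).
Definition above_first a M N :=
  slot_term M N (fun b d => z (a :: take b M) * z' (take d N)).
Definition free_slot M :=
  \sum_(b < (size M).+1) (-1) ^+ b * V 1 (z (take b M)) * w (drop b M).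

(** The new bottom is either below or above the top of the chain [a]. Algebraically, the cuts of
    [a :: N] with d > 0 cancel [above_second], and d = 0 leaves the product. *)
Lemma slot_split_second M a N : is_index (a :: N) ->
  free_slot M * E (a :: N) = bottoms_below M (a :: N) + above_second M a N.
Proof.
move=> posN; rewrite /free_slot mulr_suml -big_split /=; apply: eq_bigr => b _.
rewrite big_ord_recl /= z'0 mulr1 expr0 mulr1 -addrA -big_split /= big1 ?addr0 //.
by move=> d _; rewrite /bump /= exprS; ring.
Qed.

(** The new chain is now the one of length 1 heading [1 :: N], and its bottom is compared with the
    top of the chain [a] heading [a :: M]. *)
Lemma slot_split_first a M N : is_index (a :: M) -> is_index N ->
  w (a :: M) * E (1%N :: N) = bottoms_below (a :: M) N + above_first a M N.
Proof.
move=> posM posN; rewrite /bottoms_below /slot_term big_ord_recl /= z0 expr0 -addrA.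
rewrite -big_split /= [X in _ + X]big1 ?addr0 => [|b _]; last first.
  rewrite -big_split /= big1 // => d _.
  by rewrite /bump /= exprS; ring.
rewrite E_rec // mulr_sumr; apply: eq_bigr => d _.
by rewrite z'_cons // !mul1r; ring.
Qed.

(** Expanding both factors by their cuts leaves, for each pair of cuts, the sum over j evaluated in
    [alternating_sum]; its two end terms become [above_second] and [above_first]. *)
Lemma first_sum M a N : is_index M -> is_index (a :: N) ->
  \sum_(j < a.-1) (-1) ^+ j * (w (j.+1 :: M) * E ((a - j)%N :: N)) =
    above_second M a N + (-1) ^+ a * bottoms_below (a :: M) N.
Proof.
case: a => // a posM posN.
have /= := @slot_split_first a.+1 M N posM posN => split_first.
(* The sum is completed by the summand [j = a], namely [w (a.+1 :: M) * E (1 :: N)], which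
   [slot_split_first] then removes again. *)
suff: \sum_(j < a.+1) (-1) ^+ j * (w (j.+1 :: M) * E ((a.+1 - j)%N :: N)) =
    above_second M a.+1 N + (-1) ^+ a * above_first a.+1 M N.
  rewrite big_ord_recr /= subSnn split_first => /(canRL (addrK _)) ->.
  by rewrite exprS; ring.
transitivity (\sum_(b < (size M).+1) \sum_(d < (size N).+1)
   (-1) ^+ b * (-1) ^+ d * w (drop b M) * E (drop d N) *
   \sum_(j < a.+1) (-1) ^+ j * (c j (z (take b M)) * V (a.+1 - j)%N (z' (take d N)))).
  under [RHS]eq_bigr => b _ do under eq_bigr => d _ do rewrite mulr_sumr.
  under [RHS]eq_bigr => b _ do rewrite exchange_big.
  rewrite [RHS]exchange_big; apply: eq_bigr => j _ /=.
  have ltj : (0 < a.+1 - j)%N by rewrite subn_gt0.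
  rewrite w_rec // E_rec /= ?ltj // mulr_suml mulr_sumr; apply: eq_bigr => b _.
  rewrite !mulr_sumr; apply: eq_bigr => d _.
  by rewrite z_cons z'_cons // /c; ring.
rewrite /above_second /above_first /slot_term mulr_sumr -big_split /=.
apply: eq_bigr => b _; rewrite mulr_sumr -big_split /=; apply: eq_bigr => d _.
by rewrite alternating_sum z_cons z'_cons // /c; ring.
Qed.

Lemma bottoms_below_nil_r M : bottoms_below M [::] = free_slot M.
Proof.
by apply: eq_bigr => b _; rewrite big_ord1 /= E0 z'0 expr0 !mulr1.
Qed.

Lemma bottoms_below_nil_l N : is_index N -> bottoms_below [::] N = E (1%N :: N).
Proof.
move=> posN; rewrite /bottoms_below /slot_term big_ord1 /= w0 z0 E_rec //.
by apply: eq_bigr => d _; rewrite z'_cons // expr0 !mul1r mulr1 mulrA.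
Qed.

End CyclicSumCore.

(** * The binomial shift of a function of indices *)

Section BinomialShift.
Variable A : comNzRingType.
Implicit Types (w : seq nat -> A) (k m : seq nat).

(* The series \sum_l \prod_j C(k_j + l_j - 1, l_j) w(k + l) t^(l_1 + ... + l_r). *)
Fixpoint tshift w k : fps A :=
  if k is a :: k' then
    fps_sum (fun l => tshift (fun K => w ((a + l)%N :: K)) k' *+ 'C(a + l - 1, l))
  else fpsC (w [::]).

Lemma eq_tshift w w' k : is_index k ->
  (forall K, size K = size k -> is_index K -> w K = w' K) ->
  tshift w k = tshift w' k.
Proof.
elim: k w w' => [|a k IHk] w w' /=; first by move=> _ ->.
case/andP=> a_gt0 posk eqw; apply: eq_fps_sum => l; congr (_ *+ _).
apply: IHk => // K sK posK; apply: eqw => /=; first by rewrite sK.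
by rewrite posK addn_gt0 a_gt0.
Qed.

Lemma eq_tshift_fun w w' k : w =1 w' -> tshift w k = tshift w' k.
Proof.
elim: k w w' => [|a k IHk] w w' eqw /=; first by rewrite eqw.
apply: eq_fps_sum => l; congr (_ *+ _); exact: IHk.
Qed.

Lemma tshift_sum (I : Type) (r : seq I) (P : pred I) (F : I -> seq nat -> A) k :
  tshift (fun K => \sum_(i <- r | P i) F i K) k = \sum_(i <- r | P i) tshift (F i) k.
Proof.
elim: k F => [|a k IHk] F /=; first by rewrite raddf_sum.
rewrite -fps_sum_sum; apply: eq_fps_sum => l.
by rewrite (IHk (fun i K => F i ((a + l)%N :: K))) sumrMnl.
Qed.

Lemma tshiftB w w' k : tshift (fun K => w K - w' K) k = tshift w k - tshift w' k.
Proof.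
elim: k w w' => [|a k IHk] w w' /=; first by rewrite raddfB.
by rewrite -fps_sumB; apply: eq_fps_sum => l; rewrite IHk mulrnBl.
Qed.

Lemma tshift_lift (L : {additive A -> A}) w k :
  tshift (fun K => L (w K)) k = fps_lift L (tshift w k).
Proof.
elim: k w => [|a k IHk] w /=; first by rewrite fps_liftC.
by rewrite fps_lift_sum; apply: eq_fps_sum => l; rewrite IHk raddfMn.
Qed.

Lemma tshift_iter_lift (L : {additive A -> A}) n w k :
  tshift (fun K => iter n L (w K)) k = iter n (fps_lift L) (tshift w k).
Proof. by elim: n => //= n IHn; rewrite tshift_lift IHn. Qed.

Lemma tshift_mulCl a w k : tshift (fun K => a * w K) k = fpsC a * tshift w k.
Proof.
elim: k w => [|b k IHk] w /=; first by rewrite fpsCM.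
by rewrite -fps_sumMl; apply: eq_fps_sum => l; rewrite IHk mulrnAr.
Qed.

Lemma tshift_sign n w k : tshift (fun K => (-1) ^+ n * w K) k = (-1) ^+ n * tshift w k.
Proof.
rewrite tshift_mulCl; congr (_ * _); rewrite -signr_odd -[RHS]signr_odd.
by case: odd; rewrite ?raddfN.
Qed.

(** The binomial weight of an index is the product of the weights of its two pieces. *)
Lemma tshift_take_drop (f g : seq nat -> A) b k :
  tshift (fun K => f (take b K) * g (drop b K)) k =
    tshift f (take b k) * tshift g (drop b k).
Proof.
elim: b k f => [|b IHb] k f.
  rewrite (eq_tshift_fun (w' := fun K => f [::] * g K)); last first.
    by move=> K; rewrite take0 drop0.
  by rewrite take0 drop0 tshift_mulCl.
case: k => [|a k] /=; first by rewrite fpsCM.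
rewrite -fps_sumMr; apply: eq_fps_sum => l.
by rewrite (IHb k (fun K => f ((a + l)%N :: K))) mulrnAl.
Qed.

Lemma tshift_rcons w k a :
  tshift w (rcons k a) =
    fps_sum (fun l => tshift (fun K => w (rcons K (a + l)%N)) k *+ 'C(a + l - 1, l)).
Proof.
elim: k w => [|b k IHk] w //=.
under eq_fps_sum => l do rewrite IHk.
transitivity (fps_sum (fun l => fps_sum (fun l' =>
   tshift (fun K => w ((b + l)%N :: rcons K (a + l')%N)) k
     *+ 'C(a + l' - 1, l') *+ 'C(b + l - 1, l)))).
  apply: eq_fps_sum => l; apply: fpsP => n; rewrite coefsMn /= -sumrMnl.
  by apply: eq_bigr => j _; rewrite [in RHS]coefsMn.
rewrite fps_sum_exchange; apply: eq_fps_sum => l'.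
apply: fpsP => n; rewrite coefsMn /= -sumrMnl; apply: eq_bigr => j _.
by rewrite !coefsMn -!mulrnA mulnC.
Qed.

Lemma tshift_rot1 w k : tshift (fun K => w (rot 1 K)) k = tshift w (rot 1 k).
Proof.
case: k => [//|a k]; rewrite rot1_cons tshift_rcons /=; apply: eq_fps_sum => l.
by congr (_ *+ _); apply: eq_tshift_fun => K; rewrite rot1_cons.
Qed.

Lemma tshift_rot w i k : (i <= size k)%N ->
  is_index k -> tshift (fun K => w (rot i K)) k = tshift w (rot i k).
Proof.
elim: i w => [|i IHi] w lti posk.
  by rewrite rot0; apply: eq_tshift_fun => K; rewrite rot0.
rewrite rotS // -tshift_rot1 -(IHi (fun K => w (rot 1 K))) //; last exact: ltnW.
by apply: eq_tshift => // K sK _; rewrite rotS ?sK.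
Qed.

Lemma tshift_rev w k : tshift (fun K => w (rev K)) k = tshift w (rev k).
Proof.
elim: k w => [|a k IHk] w //=.
rewrite rev_cons tshift_rcons; apply: eq_fps_sum => l; congr (_ *+ _).
rewrite -(IHk (fun K => w (rcons K (a + l)%N))).
by apply: eq_tshift_fun => K; rewrite rev_cons.
Qed.

(** For a function of the weight alone, entries can be merged one by one: by [Vandermonde_upper] the
    shifts of two entries carry together the weights of the shift of their sum. *)
Lemma tshift_sumn (g : nat -> A) k : is_index k -> k != [::] ->
  tshift (fun K => g (sumn K)) k = tshift (fun K => g (head 0%N K)) [:: sumn k].
Proof.
elim: k g => [//|a k IHk] g /andP[a_gt0 posk] _; case: (altP (k =P [::])) => [->|k_neq0].
  rewrite /= !addn0; apply: eq_fps_sum => l.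
  by rewrite addn0.
rewrite [LHS]/=; under eq_fps_sum => l do rewrite (IHk (fun s => g (a + l + s)%N)) //=.
have sk_gt0 : (0 < sumn k)%N.
  by case: (k) posk k_neq0 => // b k' /andP[b_gt0 _] _; rewrite /= addn_gt0 b_gt0.
transitivity (fps_sum (fun l => fps_sum (fun l' =>
   fpsC (g (a + l + (sumn k + l'))%N) *+ 'C(sumn k + l' - 1, l') *+ 'C(a + l - 1, l)))).
  apply: eq_fps_sum => l; apply: fpsP => n; rewrite coefsMn /= -sumrMnl.
  by apply: eq_bigr => j _; rewrite [in RHS]coefsMn.
rewrite fps_sum2 /=; apply: eq_fps_sum => n.
transitivity (\sum_(i < n.+1) fpsC (g (a + sumn k + n)%N) *+
    ('C(a.-1 + i, i) * 'C((sumn k).-1 + (n - i), n - i))).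
  apply: eq_bigr => i _; rewrite -mulrnA mulnC.
  have := ltn_ord i => lti.
  by congr (fpsC (g _) *+ ('C(_, _) * 'C(_, _))); lia.
by rewrite sumrMnr Vandermonde_upper; congr (_ *+ 'C(_, _)); lia.
Qed.

(** The part of the cyclic sum coming from one rotation, the one that begins with the entry being
    split. *)
Definition csf_terms w k :=
  if k is a :: m then \sum_(j < a.-1) w (j.+1 :: rcons m (a - j)%N) else 0.

(** This evaluates the cut of the symmetric sum in which the whole index is reversed. The series
    over j retains only words ending in 1; in the finite sum the weights on words with given outer
    entries add up to a single binomial. *)
Lemma tshift_csf_terms w a m : (0 < a)%N ->
  \sum_(j < a.-1) tshift w ((a - j)%N :: rcons m j.+1)
  - fps_sum (fun j => (-1) ^+ j * tshift w (a :: rcons m j.+1)) =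
  tshift (csf_terms w) (a :: m) - tshift w (1%N :: rcons m a).
Proof.
case: a => // a _.
(* Only the inner entries [m] are shifted here; the outer entries [b] and [c] stay fixed, so that
   their binomials can be compared separately. *)
pose phi b c := tshift (fun K => w (b :: rcons K c)) m.
have tshift2 b c : tshift w (b.+1 :: rcons m c.+1) =
    fps_sum (fun n => \sum_(l < n.+1) phi (b + l).+1 (c + (n - l)).+1
      *+ ('C(b + l, l) * 'C(c + (n - l), n - l))).
  rewrite -(fps_sum2 (fun l l' => phi (b + l).+1 (c + l').+1
    *+ ('C(b + l, l) * 'C(c + l', l')))) /=; apply: eq_fps_sum => l.
  rewrite tshift_rcons; apply: fpsP => n; rewrite coefsMn /= -sumrMnl.
  apply: eq_bigr => j _; rewrite !coefsMn -mulrnA mulnC.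
  by rewrite !addSn !subn1.
have -> : fps_sum (fun j => (-1) ^+ j * tshift w (a.+1 :: rcons m j.+1)) =
          tshift (fun K => w (rcons K 1%N)) (a.+1 :: m).
  rewrite -[RHS](fps_sum_alternating
    (fun l => tshift (fun K => w (rcons K l.+1)) (a.+1 :: m))).
  apply: eq_fps_sum => j; rewrite -rcons_cons tshift_rcons; congr (_ * _).
  by apply: eq_fps_sum => l; rewrite !addSn subn1.
(* Compared with [csf_terms], this has the additional summand [j = b - 1], which is [w (rcons K 1)],
   the term left by the alternating series. *)
pose full K := if K is b :: K' then \sum_(j < b) w (j.+1 :: rcons K' (b - j)%N) else 0.
have -> : tshift (csf_terms w) (a.+1 :: m) =
    tshift full (a.+1 :: m) - tshift (fun K => w (rcons K 1%N)) (a.+1 :: m).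
  rewrite -tshiftB /=; apply: eq_fps_sum => l; congr (_ *+ _).
  by apply: eq_tshift_fun => K; rewrite addSn big_ord_recr /= subSnn addrK.
rewrite [RHS]addrAC; congr (_ - _); apply: (canRL (addrK _)).
transitivity (\sum_(j < a.+1) tshift w ((a.+1 - j)%N :: rcons m j.+1)).
  by rewrite big_ord_recr /= subSnn.
transitivity (fps_sum (fun n => \sum_(j < a.+1) \sum_(l < n.+1)
    phi (j + l).+1 (a - j + (n - l)).+1
      *+ ('C(j + l, l) * 'C(a - j + (n - l), n - l)))).
  rewrite fps_sum_sum (reindex_inj rev_ord_inj) /=; apply: eq_bigr => j _.
  have -> : (a.+1 - (a.+1 - j.+1))%N = j.+1 by have := ltn_ord j; lia.
  by rewrite subSS -tshift2.
rewrite /=; apply: eq_fps_sum => n.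
(* In degree n the outer entries have the constant sum a + n + 2, so they are indexed by the
   antidiagonals of a lattice rectangle. *)
transitivity (\sum_(j < (a + n).+1) phi j.+1 (a + n - j).+1 *+ 'C(a + n, n)).
  rewrite -(lattice_path_sum a n (fun j => phi j.+1 (a + n - j).+1)).
  apply: eq_bigr => j _; apply: eq_bigr => l _; congr (phi _ _.+1 *+ _).
  by have := ltn_ord j; have := ltn_ord l; lia.
rewrite sumrMnl addSn subn1 /= tshift_sum; congr (_ *+ _); apply: eq_bigr => j _.
by apply: eq_tshift_fun => K; rewrite subSn // -ltnS.
Qed.

End BinomialShift.

(** * The cyclic sum formula *)

Section CyclicSum.
Variables (A : comNzRingType) (X Y : {additive A -> A}) (w : seq nat -> A).
Hypothesis mulXX : forall f g, X f * X g = X (f * X g) + X (X f * g).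
Hypothesis mulYX : forall f g, Y f * X g = Y (f * X g) + X (Y f * g).
Hypothesis mulYY : forall f g, Y f * Y g = Y (f * Y g) + Y (Y f * g).

Fixpoint block_word (M : seq nat) : A :=
  if M is a :: M' then iter a.-1 X (Y (block_word M')) else 1.

Hypothesis w0 : w [::] = 1.
Hypothesis w_rec : forall a M, is_index (a :: M) ->
  w (a :: M) =
    \sum_(b < (size M).+1) (-1) ^+ b * (block_word (a :: take b M) * w (drop b M)).

Notation X' := (fps_lift X).
Notation Y' := (fps_lift Y).
Notation t := (fpsX A).
Notation E := (tshift w).

Definition shifted_chain a (v : fps A) : fps A :=
  fps_sum (fun l => iter (a + l - 1) X' (Y' v) *+ 'C(a + l - 1, l)).

Lemma shifted_chain1 v : shifted_chain 1 v = Y' v + t * X' (shifted_chain 1 v).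
Proof.
rewrite {1}/shifted_chain fps_sum_recl addn0; congr (_ + _ * _).
rewrite fps_lift_sum; apply: eq_fps_sum => l.
by rewrite raddfMn addnS subSS subn0 add1n subn1 /= !binn.
Qed.

Lemma shifted_chainS a v :
  shifted_chain a.+2 v = X' (shifted_chain a.+1 v) + t * X' (shifted_chain a.+2 v).
Proof.
rewrite /shifted_chain !fps_lift_sum fps_sum_recl [X in _ = X + _]fps_sum_recl.
rewrite -addrA -mulrDr -fps_sumD !bin0 !addn0 !subn1 raddfMn /=; congr (_ + _ * _).
apply: eq_fps_sum => l; rewrite !raddfMn /= !addnS !addSn !subn1 /=.
by rewrite binS mulrnDr.
Qed.

Lemma tshift_block_word a N : (0 < a)%N ->
  tshift block_word (a :: N) = shifted_chain a (tshift block_word N).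
Proof.
move=> a_gt0; apply: eq_fps_sum => l; congr (_ *+ _).
rewrite subn1; apply: etrans (tshift_iter_lift X _ (fun K => Y (block_word K)) N) _.
by rewrite tshift_lift.
Qed.

Lemma tshift_w_rec a N : is_index (a :: N) ->
  E (a :: N) = \sum_(b < (size N).+1)
    (-1) ^+ b * (tshift block_word (a :: take b N) * E (drop b N)).
Proof.
move=> posN; transitivity (tshift (fun K => \sum_(b < (size N).+1)
    (-1) ^+ b * (block_word (take b.+1 K) * w (drop b.+1 K))) (a :: N)).
  by apply: eq_tshift => // -[//|a' K] [<-] /w_rec.
rewrite tshift_sum; apply: eq_bigr => b _.
by rewrite tshift_sign tshift_take_drop.
Qed.

Lemma fpsC_w_rec a M : is_index (a :: M) ->
  fpsC (w (a :: M)) = \sum_(b < (size M).+1)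
    (-1) ^+ b * (fpsC (block_word (a :: take b M)) * fpsC (w (drop b M))).
Proof.
move=> posM; rewrite w_rec // raddf_sum; apply: eq_bigr => b _.
by rewrite raddfMsign -fpsCM.
Qed.

Notation bottoms :=
  (bottoms_below shifted_chain (@fpsC A \o w) (@fpsC A \o block_word)
    E (tshift block_word)).
Notation slot := (free_slot shifted_chain (@fpsC A \o w) (@fpsC A \o block_word)).

(** The shift of a chain of length 1 has weights C(j, j) = 1, so the new chain runs over all lengths
    j + 1; its alternating cuts are exactly the recursion of [w] at [j.+1 :: M]. *)
Lemma free_slotE M : is_index M -> slot M = fps_sum (fun j => fpsC (w (j.+1 :: M))).
Proof.
move=> posM; under eq_fps_sum => j do rewrite fpsC_w_rec //.
rewrite fps_sum_sum; apply: eq_bigr => b _.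
rewrite fps_sumMl -mulrA; congr (_ * _); rewrite fps_sumMr; congr (_ * _).
apply: eq_fps_sum => j; rewrite add1n subn1 /= binn mulr1n.
by elim: j => [|j IHj] /=; rewrite -fps_liftC // IHj.
Qed.

(** At a fixed inner cut, [above_second M a N] occurs both in the finite sum and in the series over
    j. It cancels, and two values of B remain. *)
Lemma cut_pair M a N : is_index M -> is_index (a :: N) ->
  \sum_(j < a.-1) (-1) ^+ j * (fpsC (w (j.+1 :: M)) * E ((a - j)%N :: N))
  - fps_sum (fun j => fpsC (w (j.+1 :: M)) * E (a :: N)) =
  (-1) ^+ a * bottoms (a :: M) N - bottoms M (a :: N).
Proof.
move=> posM posN.
have liftC_iter b v : fpsC (iter b X (Y v)) = iter b X' (Y' (fpsC v)).
  by elim: b => [|b IHb] /=; rewrite -fps_liftC // IHb.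
have -> := @first_sum _ X' Y' t shifted_chain (fps_lift_mul mulXX)
  (fps_lift_mul mulYX) (fps_lift_mul mulYY) (fps_lift_X X) (fps_lift_X Y)
  (@fpsX_lift_eq0 _ X) shifted_chain1 shifted_chainS
  (@fpsC A \o w) (@fpsC A \o block_word) E (tshift block_word) erefl
  (fun a M => liftC_iter a (block_word M))
  tshift_block_word fpsC_w_rec tshift_w_rec M a N posM posN.
rewrite fps_sumMr -free_slotE // (@slot_split_second _ _ _ _ _ (tshift block_word)) //.
by ring.
Qed.

Definition wS k : fps A :=
  \sum_(i < (size k).+1) (-1) ^+ sumn (drop i k) *
    (fpsC (w (take i k)) * E (rev (drop i k))).

Definition csf k : A :=
  \sum_(i < size k) csf_terms w (rot i k) - w [:: (sumn k).+1] *+ sumn k.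

Definition csf_termsS k : fps A :=
  if k is a :: m then
    \sum_(j < a.-1) wS (j.+1 :: rcons m (a - j)%N)
    - fps_sum (fun j => wS (j.+1 :: rcons m a))
  else 0.

Definition csfS k : fps A :=
  \sum_(i < size k) csf_termsS (rot i k) - wS [:: (sumn k).+1] *+ sumn k.

(** In the inner cuts the first and last entries head different factors, as [cut_pair] requires; the
    fully reversed and the uncut term are kept apart. *)
Lemma wS_cuts a m b : wS (a :: rcons m b) =
  (-1) ^+ (a + sumn m + b) * E (b :: rcons (rev m) a)
  + \sum_(p < (size m).+1) (-1) ^+ (sumn (drop p m) + b) *
      (fpsC (w (a :: take p m)) * E (b :: rev (drop p m)))
  + fpsC (w (a :: rcons m b)).
Proof.
rewrite /wS big_ord_recl take0 drop0 w0 fpsC1 mul1r /= rev_cons rev_rcons rcons_cons.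
rewrite sumn_rcons addnA -addrA; congr (_ + _).
rewrite size_rcons big_ord_recr /= /bump /= take_oversize ?size_rcons //.
rewrite drop_oversize ?size_rcons // expr0 mul1r -[E _]/(fpsC (w [::])) w0 fpsC1 mulr1.
congr (_ + _).
apply: eq_bigr => p _; have lep : (p <= size m)%N by rewrite -ltnS.
by rewrite drop_rcons // -[in take _ _]cats1 takel_cat // sumn_rcons rev_rcons.
Qed.

Definition cut_term c q : fps A :=
  (-1) ^+ sumn (drop q c) * bottoms (take q c) (rev (drop q c)).

(** The fully reversed, inner and uncut terms are evaluated by [tshift_csf_terms], [cut_pair] and
    [free_slotE]. In an inner cut the two values of B differ by moving [a] from the head of the left
    piece to the head of the reversed right piece, hence belong to consecutive rotations. *)
Lemma csf_termsS_cons a m : is_index (a :: m) ->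
  csf_termsS (a :: m) =
    fpsC (csf_terms w (a :: m)) - slot (rcons m a)
    + (-1) ^+ (sumn (a :: m)).+1 * (tshift (csf_terms w) (rev (rcons m a))
        - E (1%N :: rev (a :: m)))
    + \sum_(p < (size m).+1) (cut_term (a :: m) p.+1 - cut_term (rcons m a) p).
Proof.
move=> posc; have /andP[a_gt0 posm] := posc.
have posrc : is_index (rcons m a) by rewrite /is_index all_rcons.
have zero : \sum_(j < a.-1) (-1) ^+ (j.+1 + sumn m + (a - j)) *
      E ((a - j)%N :: rcons (rev m) j.+1)
    - fps_sum (fun j => (-1) ^+ (j.+1 + sumn m + a) * E (a :: rcons (rev m) j.+1)) =
    (-1) ^+ (sumn (a :: m)).+1 * (tshift (csf_terms w) (rev (rcons m a))
        - E (1%N :: rev (a :: m))).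
  rewrite rev_rcons rev_cons -tshift_csf_terms // mulrBr mulr_sumr -fps_sumMl.
  congr (_ - _).
    apply: eq_bigr => j _; congr (_ ^+ _ * _); rewrite /=.
    by have := ltn_ord j; lia.
  apply: eq_fps_sum => j; rewrite mulrA -exprD; congr (_ ^+ _ * _) => /=; lia.
have mid : \sum_(j < a.-1) \sum_(p < (size m).+1)
      (-1) ^+ (sumn (drop p m) + (a - j)) *
      (fpsC (w (j.+1 :: take p m)) * E ((a - j)%N :: rev (drop p m)))
    - fps_sum (fun j => \sum_(p < (size m).+1) (-1) ^+ (sumn (drop p m) + a) *
      (fpsC (w (j.+1 :: take p m)) * E (a :: rev (drop p m)))) =
    \sum_(p < (size m).+1) (cut_term (a :: m) p.+1 - cut_term (rcons m a) p).
  rewrite exchange_big fps_sum_sum -sumrB; apply: eq_bigr => p _ /=.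
  have lep : (p <= size m)%N by rewrite -ltnS.
  have postake : is_index (take p m).
    by apply/allP => x /mem_take /(allP posm).
  have posdrop : is_index (a :: rev (drop p m)).
    rewrite /is_index /= a_gt0 all_rev; apply/allP => x /mem_drop; exact: (allP posm).
  rewrite fps_sumMl; transitivity ((-1) ^+ (sumn (drop p m) + a) *
      ((-1) ^+ a * bottoms (a :: take p m) (rev (drop p m))
       - bottoms (take p m) (a :: rev (drop p m)))).
    rewrite -cut_pair // mulrBr mulr_sumr; congr (_ - _).
    apply: eq_bigr => j _; rewrite [in RHS]mulrA -exprD; congr (_ * _).
    rewrite -signr_odd -[RHS]signr_odd; congr (_ ^+ _).
    by have := ltn_ord j; lia.
  rewrite /cut_term /= mulrBr mulrA -exprD drop_rcons // -[in take p (rcons _ _)]cats1.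
  rewrite takel_cat // sumn_rcons rev_rcons; congr (_ * _ - _).
  by rewrite -[LHS]signr_odd !oddD -addbA addbb addbF signr_odd.
have full : \sum_(j < a.-1) fpsC (w (j.+1 :: rcons m (a - j)%N))
    - fps_sum (fun j => fpsC (w (j.+1 :: rcons m a))) =
    fpsC (csf_terms w (a :: m)) - slot (rcons m a).
  by rewrite free_slotE // raddf_sum.
rewrite /csf_termsS; under eq_bigr => j _ do rewrite wS_cuts.
under eq_fps_sum => j do rewrite wS_cuts.
rewrite -zero -mid -full !big_split !fps_sumD /=.
by ring.
Qed.

Lemma sum_rot_succ (U : nmodType) (k : seq nat) (F : seq nat -> U) :
  \sum_(i < size k) F (rot i.+1 k) = \sum_(i < size k) F (rot i k).
Proof.
case: (size k) (rot_size k) => [|r] rot_r; first by rewrite !big_ord0.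
by rewrite big_ord_recr [RHS]big_ord_recl /= rot_r rot0 addrC.
Qed.

Theorem cyclic_sum_formula k : is_index k -> k != [::] ->
  csfS k = fpsC (csf k) + (-1) ^+ (sumn k).+1 * tshift csf (rev k).
Proof.
move=> posk k_neq0.
have posrot i : is_index (rot i k) by rewrite /is_index (eq_all_r (mem_rot i k)).
have rotE i : (i < size k)%N -> exists a m,
    [/\ rot i k = a :: m, rot i.+1 k = rcons m a & (size m).+1 = size k].
  move=> lti; case rotik: (rot i k) => [|a m].
    by move/(congr1 size): rotik lti; rewrite size_rot => ->.
  exists a, m; rewrite rotS // rotik rot1_cons; split=> //.
  by rewrite -(size_rot i k) rotik.
have termsE (i : 'I_(size k)) : csf_termsS (rot i k) =
   fpsC (csf_terms w (rot i k)) - slot (rot i.+1 k)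
    + (-1) ^+ (sumn k).+1 * (tshift (csf_terms w) (rev (rot i.+1 k))
        - E (1%N :: rev (rot i k)))
    + \sum_(p < size k) (cut_term (rot i k) p.+1 - cut_term (rot i.+1 k) p).
  have [a [m [rotik rotiSk sm]]] := rotE i (ltn_ord i).
  have <- : sumn (rot i k) = sumn k by rewrite sumn_rot.
  by have := posrot i; rewrite rotiSk rotik -sm => /csf_termsS_cons.
(* Summing over all rotations first replaces [rot i.+1] by [rot i], after which the sum over p
   telescopes. Its ends are B with an empty right piece, a [slot], and B with an empty left piece, a
   value of [E]. *)
have cuts : \sum_(i < size k) \sum_(p < size k)
      (cut_term (rot i k) p.+1 - cut_term (rot i.+1 k) p) =
    \sum_(i < size k) (slot (rot i k) - (-1) ^+ sumn k * E (1%N :: rev (rot i k))).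
  rewrite exchange_big; under eq_bigr => p _ do
    rewrite sumrB (sum_rot_succ k (cut_term^~ p)) -sumrB.
  rewrite exchange_big; apply: eq_bigr => i _.
  rewrite -(big_mkord predT (fun p => cut_term (rot i k) p.+1 - cut_term (rot i k) p)).
  rewrite telescope_sumr // /cut_term drop0 take0.
  rewrite drop_oversize ?take_oversize ?size_rot // mul1r sumn_rot.
  rewrite bottoms_below_nil_r //; last by rewrite -[LHS]/(fpsC (w [::])) w0 fpsC1.
  rewrite bottoms_below_nil_l //=; last by rewrite /is_index all_rev.
  - by rewrite w0.
  - exact: tshift_block_word.
  - exact: tshift_w_rec.
have shift_csf : tshift csf (rev k) =
    \sum_(i < size k) tshift (csf_terms w) (rev (rot i.+1 k))
    - E [:: (sumn k).+1] *+ sumn k.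
  rewrite tshiftB; congr (_ - _).
    transitivity (tshift (fun K => \sum_(i < size k) csf_terms w (rot i K)) (rev k)).
      apply: eq_tshift => [|K]; first by rewrite /is_index all_rev.
      by rewrite size_rev => ->.
    rewrite tshift_sum (reindex_inj rev_ord_inj); apply: eq_bigr => i _ /=.
    rewrite rev_rot /rotr size_rev tshift_rot ?size_rev ?leq_subr //.
    by rewrite /is_index all_rev.
  rewrite (tshift_sumn (fun s => w [:: s.+1] *+ s)) ?sumn_rev; last 2 first.
  - by rewrite /is_index all_rev.
  - by rewrite -size_eq0 size_rev size_eq0.
  apply: fpsP => n; rewrite coefsMn /= -sumrMnl; apply: eq_bigr => l _.
  (* With s = [sumn k] this is (s + l) C(s + l - 1, l) = s C(s + l, l). *)
  rewrite !coefsMn raddfMn coefsMn addSn subn1 /= -!mulrnA; congr (_ *+ _).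
  by rewrite mul_bin_down addnK mulnC subn1.
have wS_single : wS [:: (sumn k).+1] =
    (-1) ^+ (sumn k).+1 * E [:: (sumn k).+1] + fpsC (w [:: (sumn k).+1]).
  transitivity ((-1) ^+ (sumn k).+1 * (fpsC (w [::]) * E [:: (sumn k).+1])
    + (-1) ^+ 0 * (fpsC (w [:: (sumn k).+1]) * fpsC (w [::]))).
    by rewrite /wS big_ord_recl big_ord1 /= addn0.
  by rewrite w0 fpsC1 mulr1 !mul1r.
rewrite /csfS; under eq_bigr => i _ do rewrite termsE.
rewrite wS_single shift_csf.
rewrite raddfB raddf_sum raddfMn /= !big_split /= sumrN cuts sumrB.
rewrite (sum_rot_succ k (fun c => slot c)) -!mulr_sumr sumrB exprS.
by ring.
Qed.

End CyclicSum.

(** * Shuffle products and linear extensions *)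

Section ShuffleProduct.
Variables (K : nzRingType) (R : lalgType K) (T : Type).
Variables (wd : seq T -> R) (lt : T -> R) (sp : R -> R -> R).
Hypothesis wd_span : forall P : R -> Prop,
  P 0 -> (forall f g, P f -> P g -> P (f + g)) -> (forall c u, P (c *: wd u)) ->
  forall f, P f.
Hypothesis wd_nil : wd [::] = 1.
Hypothesis wd_rcons : forall u a, wd (rcons u a) = wd u * lt a.
Hypothesis spC : commutative sp.
Hypothesis spDl : forall f g h, sp (f + g) h = sp f h + sp g h.
Hypothesis spZl : forall c f g, sp (c *: f) g = c *: sp f g.
Hypothesis sp_nil : forall u, sp (wd [::]) (wd u) = wd u.
Hypothesis sp_rcons : forall u a v b, sp (wd (rcons u a)) (wd (rcons v b)) =
  sp (wd u) (wd (rcons v b)) * lt a + sp (wd (rcons u a)) (wd v) * lt b.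

Lemma spDr f g h : sp f (g + h) = sp f g + sp f h.
Proof. by rewrite spC spDl [sp g f]spC [sp h f]spC. Qed.

Lemma spZr c f g : sp f (c *: g) = c *: sp f g.
Proof. by rewrite spC spZl spC. Qed.

Lemma sp0l f : sp 0 f = 0.
Proof. by have := spZl 0 0 f; rewrite !scale0r. Qed.

Lemma sp0r f : sp f 0 = 0.
Proof. by rewrite spC sp0l. Qed.

Lemma sp1l f : sp 1 f = f.
Proof.
elim/wd_span: f => [|f g IHf IHg|c u]; first exact: sp0r.
  by rewrite spDr IHf IHg.
by rewrite spZr -wd_nil sp_nil.
Qed.

Lemma sp_suml (I : Type) (r : seq I) (P : pred I) (F : I -> R) g :
  sp (\sum_(i <- r | P i) F i) g = \sum_(i <- r | P i) sp (F i) g.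
Proof. exact: (big_morph (sp^~ g) (fun f h => spDl f h g) (sp0l g)). Qed.

Lemma sp_sumr (I : Type) (r : seq I) (P : pred I) (F : I -> R) g :
  sp g (\sum_(i <- r | P i) F i) = \sum_(i <- r | P i) sp g (F i).
Proof. exact: (big_morph (sp g) (spDr g) (sp0r g)). Qed.

Lemma sp_letters f g a b :
  sp (f * lt a) (g * lt b) = sp f (g * lt b) * lt a + sp (f * lt a) g * lt b.
Proof.
elim/wd_span: f => [|f f' IHf IHf'|c u].
- by rewrite !mul0r !sp0l !mul0r addr0.
- by rewrite mulrDl !spDl IHf IHf' !mulrDl addrACA.
elim/wd_span: g => [|g g' IHg IHg'|d v].
- by rewrite !mul0r !sp0r !mul0r addr0.
- by rewrite mulrDl !spDr IHg IHg' !mulrDl addrACA.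
rewrite -!scalerAl -!wd_rcons !spZl !spZr sp_rcons.
by rewrite !scalerDr !scalerAl.
Qed.

(** By linearity words suffice, and induction on their total length applies: on both sides the last
    letter comes from one of the three words, and the remainders agree by induction. *)
Lemma spA f g h : sp f (sp g h) = sp (sp f g) h.
Proof.
suff spA_wd n u v s : (size u + size v + size s <= n)%N ->
    sp (wd u) (sp (wd v) (wd s)) = sp (sp (wd u) (wd v)) (wd s).
  elim/wd_span: f => [|f f' IHf IHf'|a u]; first by rewrite !sp0l.
    by rewrite !spDl IHf IHf'.
  elim/wd_span: g => [|g g' IHg IHg'|b v]; first by rewrite !(sp0r, sp0l).
    by rewrite !(spDr, spDl) IHg IHg'.
  elim/wd_span: h => [|h h' IHh IHh'|c s]; first by rewrite !sp0r.
    by rewrite !spDr IHh IHh'.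
  by rewrite !(spZl a) !(spZl b) !(spZr b) !(spZl b) !(spZr c) (spA_wd _ _ _ _ (leqnn _)).
elim: n u v s => [|n IHn] u v s.
  by case: u v s => [|??] [|??] [|??] // _; rewrite !sp_nil.
case: (lastP u) => [|u' a]; first by rewrite wd_nil !sp1l.
case: (lastP v) => [|v' b]; first by rewrite wd_nil sp1l [sp _ 1]spC sp1l.
case: (lastP s) => [|s' c]; first by rewrite wd_nil ![sp _ 1]spC !sp1l.
rewrite !size_rcons => le_n.
have IH1 : sp (wd u') (sp (wd (rcons v' b)) (wd (rcons s' c))) =
    sp (sp (wd u') (wd (rcons v' b))) (wd (rcons s' c)).
  by apply: IHn; rewrite !size_rcons; lia.
have IH2 : sp (wd (rcons u' a)) (sp (wd v') (wd (rcons s' c))) =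
    sp (sp (wd (rcons u' a)) (wd v')) (wd (rcons s' c)).
  by apply: IHn; rewrite !size_rcons; lia.
have IH3 : sp (wd (rcons u' a)) (sp (wd (rcons v' b)) (wd s')) =
    sp (sp (wd (rcons u' a)) (wd (rcons v' b))) (wd s').
  by apply: IHn; rewrite !size_rcons; lia.
move: IH1 IH2 IH3; rewrite !wd_rcons.
set U := wd u'; set V := wd v'; set W := wd s'.
rewrite (sp_letters V W) (sp_letters U V) !spDr !spDl => IH1 IH2 IH3.
rewrite (sp_letters U (sp V _)) (sp_letters U (sp (V * _) _)).
rewrite (sp_letters (sp U _) W) (sp_letters (sp (U * _) _) W) -IH1 -IH2.
by rewrite IH3 !mulrDl addrACA -[RHS]addrA [in RHS](addrCA _ (_ * lt b)).
Qed.

Section LinearExtensions.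
Variable U : eqType.
Implicit Types (r : rel U) (V s : seq U) (lab : U -> T).

(** A linear extension is an ordering in which no element is [r]-below an earlier one. The relation
    [r] need not be transitive, so generating relations can be used directly. *)
Definition lin_sum r lab V : R :=
  \sum_(s <- permutations V | pairwise (fun x y => ~~ r y x) s) wd (map lab s).

Lemma lin_sum_perm r lab V V' : perm_eq V V' -> lin_sum r lab V = lin_sum r lab V'.
Proof. by move=> eqVV'; apply/perm_big/perm_permutations. Qed.

Lemma eq_lin_sum r r' lab V : {in V &, r =2 r'} -> lin_sum r lab V = lin_sum r' lab V.
Proof.
move=> eqr; rewrite /lin_sum big_seq_cond [RHS]big_seq_cond; apply: eq_bigl => s.
rewrite mem_permutations; case perm_s: (perm_eq s V) => //=.
apply/(eq_in_pairwise (P := mem V)) => [x y xV yV|]; first by rewrite /= eqr.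
by apply/allP => x; rewrite (perm_mem perm_s).
Qed.

Lemma lin_sum_nil r lab : lin_sum r lab [::] = 1.
Proof. by rewrite /lin_sum big_mkcond big_seq1 /= wd_nil. Qed.

Lemma permutations_rcons V : uniq V -> V != [::] ->
  perm_eq (permutations V) [seq rcons s x | x <- V, s <- permutations (rem x V)].
Proof.
move=> uniqV V_neq0; apply: uniq_perm; first exact: permutations_uniq.
  apply: allpairs_uniq_dep => // [x _|]; first exact: permutations_uniq.
  by move=> [x s] [x' s'] _ _ /= /rcons_inj [-> ->].
move=> s; rewrite mem_permutations; apply/idP/allpairsPdep => [perm_s|].
  case/lastP: s perm_s => [/perm_size/esym/size0nil V0|s x perm_s].
    by rewrite V0 in V_neq0.
  have xV : x \in V by rewrite -(perm_mem perm_s) mem_rcons mem_head.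
  exists x, s; split; rewrite // mem_permutations -(perm_cons x).
  by rewrite -perm_rcons (perm_trans perm_s) // perm_to_rem.
case=> x [s' [xV]]; rewrite mem_permutations => perm_s' ->.
rewrite perm_rcons perm_sym (perm_trans (perm_to_rem xV)) // perm_cons.
by rewrite perm_sym.
Qed.

Lemma lin_sum_peel r lab V : uniq V -> V != [::] ->
  lin_sum r lab V = \sum_(x <- V | all (fun y => ~~ r x y) (rem x V))
    lin_sum r lab (rem x V) * lt (lab x).
Proof.
move=> uniqV V_neq0; rewrite /lin_sum (perm_big _ (permutations_rcons uniqV V_neq0)).
rewrite big_mkcond big_allpairs_dep [RHS]big_mkcond; apply: eq_bigr => x _ /=.
rewrite mulr_suml -big_mkcond; case: ifP => max_x.
  rewrite big_seq_cond [RHS]big_seq_cond; apply: eq_big => s; last first.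
    by rewrite map_rcons wd_rcons.
  rewrite mem_permutations pairwise_rcons; case perm_s: perm_eq => //=.
  by rewrite (eq_all_r (perm_mem perm_s)) max_x.
rewrite big_seq_cond big1 // => s /andP[]; rewrite mem_permutations => perm_s.
by rewrite pairwise_rcons (eq_all_r (perm_mem perm_s)) max_x.
Qed.

Lemma rem_cat (x : U) s1 s2 :
  rem x (s1 ++ s2) = if x \in s1 then rem x s1 ++ s2 else s1 ++ rem x s2.
Proof.
elim: s1 => //= y s1 IHs; rewrite inE IHs [x == y]eq_sym.
by case: eqP => //= _; case: ifP.
Qed.

(** The last element of an ordering of the union is a maximal element of one of the parts, which is
    the recursion of the shuffle product on last letters. *)
Lemma lin_sum_cat r lab V1 V2 : uniq (V1 ++ V2) ->
  (forall x y, x \in V1 -> y \in V2 -> ~~ r x y && ~~ r y x) ->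
  lin_sum r lab (V1 ++ V2) = sp (lin_sum r lab V1) (lin_sum r lab V2).
Proof.
have [n] := ubnP (size V1 + size V2); elim: n V1 V2 => // n IHn V1 V2 lt_n uniqV sepV.
case: (altP (V1 =P [::])) => [->|V1_neq0]; first by rewrite lin_sum_nil sp1l.
case: (altP (V2 =P [::])) => [->|V2_neq0].
  by rewrite cats0 lin_sum_nil spC sp1l.
have /and3P[uniq1 /hasPn disj uniq2] : [&& uniq V1, ~~ has (mem V1) V2 & uniq V2].
  by rewrite -cat_uniq.
have V_neq0 : V1 ++ V2 != [::] by case: (V1) V1_neq0.
have notin1 y : y \in V2 -> (y \in V1) = false by move=> /disj /negbTE.
rewrite (lin_sum_peel _ _ uniqV V_neq0) big_cat /=.
rewrite [in RHS](lin_sum_peel _ _ uniq1 V1_neq0) [in RHS](lin_sum_peel _ _ uniq2 V2_neq0).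
rewrite sp_suml; under [RHS]eq_bigr => x _ do rewrite sp_sumr.
under [RHS]eq_bigr => x _ do under eq_bigr => y _ do rewrite sp_letters.
under [RHS]eq_bigr => x _ do rewrite big_split.
rewrite big_split /= [X in _ = _ + X]exchange_big /=; congr (_ + _).
  rewrite big_seq_cond [RHS]big_seq_cond; apply: eq_big => [x|x /andP[xV1 _]].
    case xV1: (x \in V1) => //=; rewrite rem_cat xV1 all_cat; apply: andb_idr => _.
    by apply/allP => y /(sepV x y xV1)/andP[].
  rewrite rem_cat xV1 -mulr_suml -sp_sumr -lin_sum_peel // IHn //.
  - rewrite size_rem //; case: (V1) xV1 lt_n => // ? ? _; rewrite /=; lia.
  - by have := rem_uniq x uniqV; rewrite rem_cat xV1.
  - by move=> x' y /mem_rem; exact: sepV.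
rewrite big_seq_cond [RHS]big_seq_cond; apply: eq_big => [y|y /andP[yV2 _]].
  case yV2: (y \in V2) => //=; rewrite rem_cat notin1 // all_cat.
  by apply: andb_idl => _; apply/allP => x /sepV/(_ yV2)/andP[].
have yV1 := notin1 y yV2.
rewrite rem_cat yV1 -mulr_suml -sp_suml -lin_sum_peel // IHn //.
- rewrite size_rem //; case: (V2) yV2 lt_n => // ? ? _; rewrite /=; lia.
- by have := rem_uniq y uniqV; rewrite rem_cat yV1.
- by move=> x y' xV1 /mem_rem; exact: sepV.
Qed.

(** Every element but the last has a successor under [r], so only the last one can be peeled off. *)
Lemma lin_sum_chain r lab s : uniq s -> sorted r s ->
  pairwise (fun x y => ~~ r y x) s -> lin_sum r lab s = wd (map lab s).
Proof.
elim/last_ind: s => [|s x IHs]; first by rewrite lin_sum_nil wd_nil.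
move=> uniq_s sort_s; rewrite pairwise_rcons => /andP[max_x pair_s].
have := uniq_s; rewrite rcons_uniq => /andP[xNs uniq_s'].
have sx_neq0 : rcons s x != [::] by case: (s).
rewrite lin_sum_peel // map_rcons wd_rcons -cats1 big_cat /= big_cons big_nil.
have rem_x : rem x (s ++ [:: x]) = s.
  by rewrite rem_cat (negbTE xNs) /= eqxx cats0.
have sort_s' : sorted r s by move: sort_s; rewrite -cats1 => /cat_sorted2[].
rewrite rem_x max_x addr0 IHs // big_seq_cond big1 ?add0r // => y /andP[ys /allP max_y].
have [z zs ryz] : exists2 z, z \in rcons s x & (y != z) && r y z.
  have := uniq_s; have := sort_s; case/splitPr: ys => s1 s2.
  rewrite rcons_cat rcons_cons => /cat_sorted2[_ sort_y]; rewrite cat_uniq.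
  case/and3P=> _ _; case: (rcons s2 x) (size_rcons s2 x) sort_y => // z s' _ /=.
  case/andP=> ryz _ /andP[]; rewrite inE negb_or => /andP[neq_yz _] _; exists z.
    by rewrite mem_cat !inE eqxx !orbT.
  by rewrite neq_yz.
case/andP: ryz => neq_yz; apply: contraTeq => _; apply: max_y.
by rewrite cats1 mem_rem_uniq // !inE eq_sym neq_yz.
Qed.

Lemma pairwise_index (p : rel U) s : uniq s ->
  reflect {in s &, forall x y, (index x s < index y s)%N -> p x y} (pairwise p s).
Proof.
case: s => [|x0 s] uniq_s; first by left.
apply: (iffP (pairwiseP x0)) => [pair_s x y xs ys lt_xy|pair_s i j].
  by rewrite -(nth_index x0 xs) -(nth_index x0 ys) pair_s // inE index_mem.
rewrite !inE => lti ltj lt_ij; apply: pair_s; rewrite ?mem_nth //.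
by rewrite !index_uniq.
Qed.

(** In every ordering exactly one of [x] and [y] comes first. *)
Lemma lin_sum_split r lab V x y : uniq V -> x \in V -> y \in V -> x != y ->
  lin_sum r lab V =
    lin_sum (fun a b => r a b || (a == x) && (b == y)) lab V
    + lin_sum (fun a b => r a b || (a == y) && (b == x)) lab V.
Proof.
move=> uniqV xV yV neq_xy.
have pairwise_or s u v : perm_eq s V -> u \in V -> v \in V -> u != v ->
    pairwise (fun a b => ~~ (r b a || (b == u) && (a == v))) s =
    pairwise (fun a b => ~~ r b a) s && (index u s < index v s)%N.
  move=> perm_s uV vV neq_uv.
  have uniq_s : uniq s by rewrite (perm_uniq perm_s).
  apply/(pairwise_index _ uniq_s)/andP => [pair_s|[]]; last first.
    move=> /(pairwise_index _ uniq_s) pair_s lt_uv.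
    move=> a b As Bs lt_ab; rewrite negb_or pair_s //=.
    apply/negP => /andP[/eqP bu /eqP av].
    by move: lt_ab; rewrite av bu ltnNge ltnW.
  split; first by apply/pairwise_index => // a b As Bs /(pair_s a b As Bs) /norP[].
  rewrite ltnNge leq_eqVlt negb_or; apply/andP; split.
    apply: contra neq_uv => /eqP /index_inj ->; rewrite ?(perm_mem perm_s) //.
  apply/negP => /pair_s; rewrite !(perm_mem perm_s) => /(_ vV uV).
  by rewrite !eqxx orbT.
rewrite /lin_sum (bigID (fun s => index x s < index y s)%N) /=.
congr (_ + _); rewrite big_seq_cond [RHS]big_seq_cond; apply: eq_bigl => s;
  rewrite mem_permutations; case perm_s: perm_eq => //=.
  by rewrite pairwise_or.
rewrite pairwise_or // 1?eq_sym // -leqNgt leq_eqVlt; congr (_ && _).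
case: eqP => //= /index_inj; rewrite !(perm_mem perm_s) => /(_ x yV xV) eq_yx.
by rewrite eq_yx ?eqxx in neq_xy.
Qed.

End LinearExtensions.

Lemma lin_sum_map (U U' : eqType) (v : U -> U') (r : rel U) (r' : rel U')
    (lab : U -> T) (lab' : U' -> T) V :
  injective v -> (forall x y, r' (v x) (v y) = r x y) -> (forall x, lab' (v x) = lab x) ->
  lin_sum r' lab' (map v V) = lin_sum r lab V.
Proof.
move=> inj_v eq_r eq_lab; rewrite /lin_sum.
have perm_map_v : perm_eq (permutations (map v V)) (map (map v) (permutations V)).
  apply: uniq_perm; rewrite ?permutations_uniq //.
    by rewrite map_inj_uniq ?permutations_uniq //; exact: inj_map.
  move=> s; rewrite mem_permutations; apply/idP/mapP => [|[s' perm_s ->]].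
    move=> perm_s; have [s' Es'] : exists s', s = map v s'.
      have : {subset s <= map v V} by move=> x; rewrite (perm_mem perm_s).
      elim: s {perm_s} => [|x s IHs] sub; first by exists [::].
      have /mapP[y _ ->] := sub x (mem_head _ _).
      have [|s' ->] := IHs; last by exists (y :: s').
      by move=> z zs; apply: sub; rewrite inE zs orbT.
    exists s' => //; rewrite mem_permutations; apply: (perm_map_inj inj_v).
    by rewrite -Es'.
  by rewrite perm_map // -mem_permutations.
rewrite (perm_big _ perm_map_v) big_map; apply: eq_big => [s|s _].
  by rewrite pairwise_map; apply: eq_pairwise => x y /=; rewrite eq_r.
by rewrite -map_comp; congr wd; apply: eq_map => x /=.
Qed.

(** * Cutting the zigzag poset *)

Section Zigzag.
Variables (x y : T) (k : seq nat).
Hypothesis k_gt0 : all (fun a => 0 < a)%N k.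

Definition zlab (p : nat * nat) : T := if p.2 == 0%N then y else x.

(* The element (i, m) is p_(i+1, m+1) of X^*(k). The chains are always linked
   upwards; below level b the top of chain i+1 is put below the bottom of chain i,
   and from level d on the bottom of chain i is put below the top of chain i+1. *)
Definition zlink b d : rel (nat * nat) := fun p q =>
  [|| (q.1 == p.1) && (q.2 == p.2.+1),
      [&& p.1 == q.1.+1, (p.1 < b)%N, p.2.+1 == nth 0%N k p.1 & q.2 == 0%N]
    | [&& q.1 == p.1.+1, (d <= p.1)%N, p.2 == 0%N & q.2.+1 == nth 0%N k q.1]].

Definition verts b e := [seq (i, m) | i <- iota b (e - b), m <- iota 0 (nth 0%N k i)].

Lemma mem_verts b e p : (p \in verts b e) = (b <= p.1 < e)%N && (p.2 < nth 0%N k p.1)%N.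
Proof.
clear k_gt0; apply/allpairsPdep/idP => [[i [m [Hi Hm ->]]]|].
  by move: Hi Hm; rewrite !mem_iota /=; lia.
by case: p => i m /= H; exists i, m; rewrite !mem_iota; split=> //; lia.
Qed.

Lemma uniq_verts b e : uniq (verts b e).
Proof.
apply: allpairs_uniq_dep => [|i _|]; try exact: iota_uniq.
by move=> [i m] [i' m'] _ _ /= [-> ->].
Qed.

Lemma verts_cat b e : (b <= e)%N -> perm_eq (verts 0 e) (verts 0 b ++ verts b e).
Proof.
move=> le_be; apply: uniq_perm; rewrite ?uniq_verts // ?cat_uniq ?uniq_verts /=.
  rewrite andbT; apply/hasPn => p pbe.
  by have : p \notin verts 0 b by move: pbe; rewrite !mem_verts; lia.
by move=> p; rewrite mem_cat !mem_verts; lia.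
Qed.

Fixpoint block_letters (M : seq nat) : seq T :=
  if M is a :: M' then block_letters M' ++ y :: nseq a.-1 x else [::].

Lemma block_letters_rcons M a :
  block_letters (rcons M a) = (y :: nseq a.-1 x) ++ block_letters M.
Proof. by elim: M => [|b M IHM] /=; rewrite ?cats0 // IHM -cat_cons -catA. Qed.

Definition chain b := [seq (b, m) | m <- iota 0 (nth 0%N k b)].

(** The first [b] chains stacked into one, read from bottom to top, so that chains of larger index
    come first. *)
Fixpoint chains b := if b is b'.+1 then chain b' ++ chains b' else [::].

Lemma mem_chains b p : (p \in chains b) = (p.1 < b)%N && (p.2 < nth 0%N k p.1)%N.
Proof.
elim: b => [|b IHb]; rewrite ?in_nil //= mem_cat IHb.
have -> : (p \in chain b) = (p.1 == b) && (p.2 < nth 0%N k p.1)%N.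
  apply/mapP/idP => [[m]|/andP[/eqP p1 p2]].
    by rewrite mem_iota => Hm -> /=; rewrite eqxx.
  by exists p.2; rewrite ?mem_iota -?p1 //; case: (p).
by rewrite -andb_orl ltnS (leq_eqVlt p.1).
Qed.

Lemma uniq_chains b : uniq (chains b).
Proof.
elim: b => //= b IHb; rewrite cat_uniq IHb andbT map_inj_uniq ?iota_uniq => [|i j [] //].
apply/hasPn => p; rewrite mem_chains => /andP[ltp _].
by apply/mapP => -[m _ pE]; rewrite pE ltnn in ltp.
Qed.

Lemma map_zlab_chains b : (b <= size k)%N ->
  map zlab (chains b) = block_letters (take b k).
Proof.
elim: b => [|b IHb] lebk; first by rewrite take0.
rewrite (take_nth 0%N) // block_letters_rcons [LHS]map_cat IHb ?(ltnW lebk) //.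
congr (_ ++ _).
have /allP/(_ (nth 0%N k b)) := k_gt0; rewrite mem_nth // => /(_ isT).
rewrite /chain; case: (nth 0%N k b) => // a _; rewrite /= -map_comp; congr cons.
rewrite (iotaDl 1 0) -map_comp -[X in nseq X](size_iota 0 a).
by elim: (iota 0 a) => //= m s ->.
Qed.

Lemma k_nth i : (i < size k)%N -> (0 < nth 0%N k i)%N.
Proof. by move=> lti; apply: (allP k_gt0); apply: mem_nth. Qed.

Lemma path_chain b B d m n s :
  path (zlink B d) (b, m) ([seq (b, j) | j <- iota m.+1 n] ++ s) =
    path (zlink B d) (b, m + n)%N s.
Proof.
elim: n m => [|n IHn] m /=; first by rewrite addn0.
by rewrite IHn addSnnS /zlink /= !eqxx.
Qed.

Lemma sorted_chains b B d : (b <= B)%N -> (b <= size k)%N ->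
  sorted (zlink B d) (chains b).
Proof.
elim: b => [//|b IHb] leB lek.
have {}IHb : sorted (zlink B d) (chains b) by apply: IHb; lia.
have := k_nth lek; rewrite /= /chain; case kb: (nth _ k b) => [//|a] _ /=.
rewrite path_chain add0n; case: b IHb leB lek kb => [//|b] /= sort_b leB lek kb.
have := k_nth (ltnW lek); move: sort_b; rewrite /= /chain.
case: (nth _ k b) => [//|a'] /= -> _; rewrite andbT /zlink /= kb !eqxx.
by rewrite leB orbT.
Qed.

Lemma pairwise_chains b B d : (b <= B)%N -> (B <= d.+1)%N ->
  pairwise (fun p q => ~~ zlink B d q p) (chains b).
Proof.
elim: b => [//|b IHb] leB leBd /=; rewrite pairwise_cat IHb ?(ltnW leB) // andbT.
apply/andP; split.
  apply/allrelP => p [i j] /mapP[m _ ->]; rewrite mem_chains => /andP[/= ltq _].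
  by rewrite /zlink /=; lia.
rewrite pairwise_map.
have := iota_ltn_sorted 0 (nth 0%N k b); rewrite (sorted_pairwise ltn_trans).
by apply: sub_pairwise => i j; rewrite /zlink /=; lia.
Qed.

(** The bound on [b] by [B] stacks all the chains, and [B <= d.+1] keeps zigzag links away from
    them, so the vertices form a single chain. *)
Lemma lin_sum_chains b B d : (b <= B)%N -> (B <= d.+1)%N -> (b <= size k)%N ->
  lin_sum (zlink B d) zlab (verts 0 b) = wd (block_letters (take b k)).
Proof.
move=> leB leBd lek; rewrite -map_zlab_chains // -(@lin_sum_chain _ (zlink B d)).
- apply: lin_sum_perm; apply: uniq_perm; rewrite ?uniq_verts ?uniq_chains // => p.
  by rewrite mem_chains mem_verts.
- exact: uniq_chains.
- exact: sorted_chains.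
- exact: pairwise_chains.
Qed.

(** [F b] severs the zigzag after [b] chains and stacks these. In [G b], for b > 0, the bottom of
    the stack is still linked to the remaining zigzag. *)
Let F b :=
  sp (wd (block_letters (take b k))) (lin_sum (zlink b b) zlab (verts b (size k))).
Let G b := lin_sum (zlink b b.-1) zlab (verts 0 (size k)).

(** The bottom of the stack and the top of the next chain are unrelated in the severed poset.
    Placing the bottom below gives [G b]; placing the top below lengthens the stack and gives
    [G b.+1]. *)
Lemma cut_split b : (0 < b < size k)%N -> F b = G b + G b.+1.
Proof.
move=> /andP[b_gt0 ltb].
have kb := k_nth ltb.
transitivity (lin_sum (zlink b b) zlab (verts 0 (size k))).
  rewrite /F -(@lin_sum_chains b b b) ?leqnSn ?(ltnW ltb) // -lin_sum_cat.
  - by apply: lin_sum_perm; rewrite perm_sym verts_cat // ltnW.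
  - by rewrite -(perm_uniq (verts_cat (ltnW ltb))) uniq_verts.
  - by move=> [i m] [j n]; rewrite !mem_verts /zlink /=; lia.
rewrite (@lin_sum_split _ _ _ _ (b.-1, 0%N) (b, (nth 0%N k b).-1)) ?uniq_verts //.
- congr (_ + _); apply: eq_lin_sum => -[i m] [j n];
    by rewrite !mem_verts /zlink !xpair_eqE /= => ? ?;
    case: (eqVneq i b) => [->|neq_i]; case: (eqVneq j b) => [->|neq_j];
    apply/idP/idP; lia.
- by rewrite mem_verts /= k_nth; lia.
- by rewrite mem_verts /=; lia.
- by rewrite xpair_eqE; lia.
Qed.

Lemma cut_first : k != [::] -> F 0%N = G 1%N.
Proof.
move=> k_neq0; rewrite /F take0 /= wd_nil sp1l; apply: eq_lin_sum => -[i m] [j n].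
by rewrite !mem_verts /zlink /=; lia.
Qed.

Lemma cut_last : k != [::] -> F (size k) = G (size k).
Proof.
rewrite -size_eq0 => k_neq0; rewrite /F /G.
have -> : lin_sum (zlink (size k) (size k)) zlab (verts (size k) (size k)) = 1.
  by rewrite /verts subnn lin_sum_nil.
rewrite spC sp1l -(@lin_sum_chains _ (size k) (size k)) //.
by apply: eq_lin_sum => -[i m] [j n]; rewrite !mem_verts /zlink /=; lia.
Qed.

Lemma alternating_cuts : k != [::] ->
  \sum_(b < (size k).+1) (if odd b then - F b else F b) = 0.
Proof.
move=> k_neq0; have : (0 < size k)%N by rewrite lt0n size_eq0.
have partial n : (n < size k)%N ->
    \sum_(b < n.+1) (if odd b then - F b else F b) = if odd n then - G n.+1 else G n.+1.
  elim: n => [|n IHn] ltn; first by rewrite big_ord1 /= cut_first.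
  rewrite big_ord_recr /= IHn ?(ltnW ltn) // cut_split ?ltn //=.
  by case: odd; rewrite /= ?opprD ?addNKr ?addKr // addrA subrr add0r.
rewrite big_ord_recr cut_last //; case sk: (size k) => [//|n] _ /=.
by rewrite partial ?sk //; case: odd; rewrite ?subrr ?addNr.
Qed.

End Zigzag.
End ShuffleProduct.

(** * The words of a poset *)

Lemma word_nil : word [::] = 1.
Proof. by congr mkmalgU; apply: val_inj; rewrite /= fm1. Qed.

Lemma wordM u v : word u * word v = word (u ++ v).
Proof.
rewrite /word malgM_def fgmulUU mulr1; congr mkmalgU.
by apply: val_inj; rewrite /= fmM.
Qed.

Lemma word_rcons u a : word (rcons u a) = word u * let_ a.
Proof. by rewrite /let_ wordM cats1. Qed.

Lemma word_prod (s : seq letter) : word s = \prod_(a <- s) let_ a.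
Proof.
elim: s => [|a s IHs]; first by rewrite big_nil word_nil.
by rewrite big_cons -IHs wordM.
Qed.

Section PosetWords.
Variables (d : Order.disp_t) (X : finPOrderType d) (lab : X -> letter).

(** The rank [enum_rank p] is a mere default: when [s] enumerates [X], the index of [p] is always in
    range. *)
Definition ext_of_seq (s : seq X) : {ffun X -> 'I_#|X|} :=
  [ffun p => insubd (enum_rank p) (index p s)].

Lemma ext_of_seqE s p : perm_eq s (enum X) -> ext_of_seq s p = index p s :> nat.
Proof.
move=> perm_s; have lt_p : (index p s < #|X|)%N.
  by rewrite cardE -(perm_size perm_s) index_mem (perm_mem perm_s) mem_enum.
by rewrite ffunE val_insubd lt_p.
Qed.

Lemma ext_of_seq_linear s : perm_eq s (enum X) ->
  linear_ext (ext_of_seq s) = pairwise (fun p q => ~~ (q < p)%O) s.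
Proof.
move=> perm_s; have uniq_s : uniq s by rewrite (perm_uniq perm_s) enum_uniq.
have in_s p : p \in s by rewrite (perm_mem perm_s) mem_enum.
have inj_index p q : index p s = index q s -> p = q.
  by move/index_inj; apply.
have -> : linear_ext (ext_of_seq s) =
    [forall p, forall q, (p < q)%O ==> (index p s < index q s)%N].
  rewrite /linear_ext (_ : injectiveb _); last first.
    by apply/injectiveP => p q /(congr1 val) /=; rewrite !ext_of_seqE // => /inj_index.
  by apply: eq_forallb => p; apply: eq_forallb => q; rewrite !ext_of_seqE.
apply/forallP/(pairwise_index _ uniq_s) => [lin p q _ _ lt_pq|lin p].
  apply: contraL lt_pq => lt_qp; rewrite -leqNgt ltnW //.
  by have /forallP/(_ p)/implyP/(_ lt_qp) := lin q.
apply/forallP => q; apply/implyP => lt_pq; rewrite ltnNge leq_eqVlt negb_or.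
apply/andP; split; last by apply: contraL lt_pq => /lin ->.
by apply: contraL lt_pq => /eqP /inj_index ->; rewrite Order.POrderTheory.ltxx.
Qed.

Lemma linear_ext_seq (f : {ffun X -> 'I_#|X|}) : linear_ext f ->
  exists2 s, perm_eq s (enum X) & f = ext_of_seq s.
Proof.
case/andP=> /injectiveP inj_f _.
have [g fK gK] : bijective f by apply: (inj_card_bij inj_f); rewrite card_ord.
have inj_g := can_inj gK.
have perm_s : perm_eq (map g (enum 'I_#|X|)) (enum X).
  apply: uniq_perm; rewrite ?enum_uniq ?(map_inj_uniq inj_g) ?enum_uniq // => p.
  by rewrite mem_enum; apply/mapP; exists (f p); rewrite ?mem_enum ?fK.
exists (map g (enum 'I_#|X|)) => //; apply/ffunP => p; apply: val_inj.
by rewrite /= ext_of_seqE // -{2}(fK p) (index_map inj_g) index_enum_ord.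
Qed.

Lemma W_lin_sum : W lab = lin_sum word (fun p q => (p < q)%O) lab (enum X).
Proof.
pose ok (s : seq X) := pairwise (fun p q => ~~ (q < p)%O) s.
pose wt f := \prod_(i < #|X|) \prod_(p | (f : {ffun X -> 'I_#|X|}) p == i) let_ (lab p).
have perm_of s : s \in permutations (enum X) -> perm_eq s (enum X).
  by rewrite mem_permutations.
transitivity (\sum_(f <- [seq ext_of_seq s | s <- permutations (enum X) & ok s]) wt f).
  rewrite -[LHS]big_filter; apply: perm_big; apply: uniq_perm.
  - by rewrite filter_uniq // index_enum_uniq.
  - rewrite map_inj_in_uniq ?filter_uniq ?permutations_uniq // => s s'.
    rewrite !mem_filter => /andP[_ /perm_of perm_s] /andP[_ /perm_of perm_s'] eq_ss'.
    have eq_index p : index p s = index p s'.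
      by rewrite -(ext_of_seqE p perm_s) -(ext_of_seqE p perm_s') eq_ss'.
    have size_ss' : size s = size s' by rewrite (perm_size perm_s) (perm_size perm_s').
    case: s {eq_ss'} eq_index size_ss' perm_s => [|x0 s] eq_index size_ss' perm_s.
      by apply/esym/size0nil; rewrite -size_ss'.
    apply: (@eq_from_nth _ x0) => // i lti.
    have uniq_s : uniq (x0 :: s) by rewrite (perm_uniq perm_s) enum_uniq.
    rewrite -[in RHS](index_uniq x0 lti uniq_s) eq_index nth_index //.
    by rewrite (perm_mem perm_s') mem_enum.
  - move=> f; rewrite mem_filter mem_index_enum andbT; apply/idP/mapP => [lin_f|].
      have [s perm_s fE] := linear_ext_seq lin_f; exists s => //.
      by rewrite mem_filter mem_permutations perm_s andbT /ok -ext_of_seq_linear -?fE.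
    case=> s; rewrite mem_filter => /andP[ok_s /perm_of perm_s] ->.
    by rewrite ext_of_seq_linear.
rewrite big_map big_filter /lin_sum big_seq_cond [RHS]big_seq_cond.
apply: eq_bigr => s /andP[/perm_of perm_s _]; rewrite word_prod big_map /wt.
have uniq_s : uniq s by rewrite (perm_uniq perm_s) enum_uniq.
have size_s : size s = #|X| by rewrite (perm_size perm_s) cardE.
(* The empty poset is treated apart, as [nth] needs a default element of [X]. *)
case: (posnP #|X|) => [X0|X_gt0].
  have -> : s = [::] by apply: size0nil; rewrite size_s.
  by rewrite big_nil big1 // => -[i lti] _; exfalso; move: (lti); rewrite X0.
case: s perm_s uniq_s size_s => [|x0 s] perm_s uniq_s size_s.
  by rewrite -size_s in X_gt0.
rewrite (big_nth x0) big_mkord size_s; apply: eq_bigr => i _.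
rewrite (big_pred1 (nth x0 (x0 :: s) i)) // => p /=.
have lti : (i < size (x0 :: s))%N by rewrite size_s.
rewrite -val_eqE /= ext_of_seqE //; apply/eqP/eqP => [<-|->].
  by rewrite nth_index // (perm_mem perm_s) mem_enum.
by rewrite index_uniq.
Qed.

End PosetWords.

(** An ordering respecting the generating relations respects their transitive closure, by induction
    along a path of generators. *)
Lemma wstar_gen k :
  wstar k = lin_sum word (@Xstar_gen k) (@Xstar_label k) (enum {: Xstar k}).
Proof.
rewrite /wstar W_lin_sum /lin_sum big_seq_cond [RHS]big_seq_cond.
apply: eq_bigl => s; rewrite mem_permutations; case perm_s: perm_eq => //=.
have uniq_s : uniq s by rewrite (perm_uniq perm_s) enum_uniq.
have in_s p : p \in s by rewrite (perm_mem perm_s) mem_enum.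
apply/(pairwise_index _ uniq_s)/(pairwise_index _ uniq_s) => lin p q _ _ lt_pq.
  apply: contra (lin p q (in_s p) (in_s q) lt_pq) => gen_qp.
  rewrite Order.POrderTheory.lt_neqAle; apply/andP; split; last exact: connect1.
  apply: contraL gen_qp => /eqP ->; rewrite /Xstar_gen; apply/norP; split.
    by rewrite negb_and (ltn_eqF (leqnn _)) orbT.
  by rewrite !negb_and (ltn_eqF (leqnn _)) !orbT.
apply/negP; rewrite Order.POrderTheory.lt_neqAle => /andP[_ /connectP[t path_t last_t]].
suff : (index q s <= index p s)%N by rewrite leqNgt lt_pq.
elim: t q path_t last_t {lt_pq} => [|r t IHt] q /=; first by move=> _ ->.
case/andP=> gen_qr path_t last_t; apply: leq_trans (IHt r path_t last_t).
by rewrite leqNgt; apply: contraL gen_qr => /lin; apply.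
Qed.

(** Shifting the chain numbers by [b] places the posets of all final pieces of [k] in one common
    grid, where cuts can be compared. *)
Lemma wstar_drop k b : (b <= size k)%N ->
  wstar (drop b k) = lin_sum word (zlink k b b) (zlab lx ly) (verts k b (size k)).
Proof.
move=> leb; pose v (p : Xstar (drop b k)) : nat * nat :=
  ((b + tag p)%N, nat_of_ord (tagged p)).
have inj_v : injective v.
  case=> [i m] [j n] [/addnI/val_inj eq_ij /=].
  by case: j / eq_ij n => n /val_inj ->.
rewrite wstar_gen -(@lin_sum_map _ _ _ word _ _ v (@Xstar_gen (drop b k)) (zlink k b b)
  (@Xstar_label (drop b k)) (zlab lx ly)) //.
- apply: lin_sum_perm; apply: uniq_perm; rewrite ?uniq_verts //.
    by rewrite (map_inj_uniq inj_v) enum_uniq.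
  move=> [i m]; rewrite mem_verts /=.
  apply/idP/idP => [/mapP[p _ [-> ->]]|/andP[/andP[lebi lti] ltm]].
    case: p => [[j ltj] [m' ltm']] /=; move: (ltj) (ltm').
    by rewrite /= size_drop nth_drop; lia.
  have ltj : (i - b < size (drop b k))%N by rewrite size_drop; lia.
  have ltm' : (m < nth 0%N (drop b k) (Ordinal ltj))%N.
    by rewrite /= nth_drop subnKC.
  apply/mapP; exists (Tagged (fun j : 'I_(size (drop b k)) => 'I_(nth 0%N (drop b k) j))
    (Ordinal ltm')); rewrite ?mem_enum //.
  by rewrite /v /= subnKC.
- by move=> p q; rewrite /zlink /Xstar_gen /= -(nth_drop b 0%N k (tag q)); lia.
Qed.

(** * The shuffle algebra *)

Lemma word_span (P : H -> Prop) :
  P 0 -> (forall f g, P f -> P g -> P (f + g)) -> (forall c s, P (c *: word s)) ->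
  forall f, P f.
Proof.
move=> P0 PD Pw f; rewrite (monalgE f); elim/big_ind: _ => // -[s] _.
rewrite (_ : << _ *g _ >> = f@_(FMonom s) *: word s) //.
apply/malgP => m; rewrite mcoeffZ !mcoeffU.
by case: eqP; rewrite (mulr1n, mulr0n) (mulr1, mulr0).
Qed.

(** The form [mmap] is additive and insensitive to enlarging the support, which gives the linearity
    of [sh]. *)
Lemma shE f g : sh f g = mmap malgC
  (fun u : {fmonom letter} => mmap malgC (fun v : {fmonom letter} => sh_word u v) g) f.
Proof.
rewrite /sh /mmap; apply: eq_bigr => u _; rewrite mulr_sumr; apply: eq_bigr => v _.
by rewrite (mul_malgC f@_u) (mul_malgC g@_v) (scalerA f@_u).
Qed.

Lemma shDl f g h : sh (f + g) h = sh f h + sh g h.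
Proof. by rewrite !shE raddfD. Qed.

Lemma shZl c f g : sh (c *: f) g = c *: sh f g.
Proof.
rewrite !shE (mmapEw (msuppZ_le c f)) mmapE scaler_sumr.
apply: eq_bigr => u _; rewrite mcoeffZ (mul_malgC (c * _)) (mul_malgC f@_u).
by rewrite scalerA.
Qed.

Lemma sh_rev_cons a p b q :
  sh_rev (a :: p) (b :: q) = sh_rev p (b :: q) * let_ a + sh_rev (a :: p) q * let_ b.
Proof. by []. Qed.

Lemma sh_word_comm u v : sh_word u v = sh_word v u.
Proof.
rewrite /sh_word; move: (rev u) (rev v) => p; elim: p => [|a p IHp] q.
  by case: q.
elim: q => [|b q IHq]; first by [].
by rewrite !sh_rev_cons IHp IHq; exact: (@addrC H).
Qed.

Lemma shC : commutative sh.
Proof.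
move=> f g; rewrite /sh exchange_big; apply: eq_bigr => v _; apply: eq_bigr => u _.
by rewrite (mulrC (f@_u)) sh_word_comm.
Qed.

Lemma sh_nil u : sh (word [::]) (word u) = word u.
Proof. by rewrite sh_wordE sh_word_nil_l. Qed.

Lemma sh_rcons u a v b : sh (word (rcons u a)) (word (rcons v b)) =
  sh (word u) (word (rcons v b)) * let_ a + sh (word (rcons u a)) (word v) * let_ b.
Proof. by rewrite !sh_wordE sh_word_rcons. Qed.

Lemma shA : associative sh.
Proof.
exact: (spA word_span word_nil word_rcons shC shDl shZl sh_nil sh_rcons).
Qed.

Lemma sh1 : left_id 1 sh.
Proof. exact: (sp1l word_span word_nil shC shDl shZl sh_nil). Qed.

Lemma sh_letters f g a b :
  sh (f * let_ a) (g * let_ b) = sh f (g * let_ b) * let_ a + sh (f * let_ a) g * let_ b.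
Proof. exact: (sp_letters word_span word_rcons shC shDl shZl sh_rcons). Qed.

(** A copy of [H] whose ring product is the shuffle product; concatenation stays the product of
    [H]. *)
Definition Hsh : Type := H.
HB.instance Definition _ := GRing.Zmodule.copy Hsh H.

Fact Hsh_one_neq0 : (1 : H) != 0 :> Hsh. Proof. exact: (@oner_neq0 H). Qed.

HB.instance Definition _ := GRing.Zmodule_isComNzRing.Build Hsh
  shA shC sh1 shDl Hsh_one_neq0.

Definition append (a : letter) (f : Hsh) : Hsh := (f : H) * let_ a.

Fact append_additive a : zmod_morphism (append a).
Proof. move=> f g; exact: (@mulrBl H). Qed.
HB.instance Definition _ a :=
  GRing.isZmodMorphism.Build Hsh Hsh (append a) (append_additive a).

Lemma append_mul a b (f g : Hsh) :
  append a f * append b g = append a (f * append b g) + append b (append a f * g).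
Proof. exact: sh_letters. Qed.

Lemma block_wordE M :
  block_word (append lx) (append ly) M = word (block_letters lx ly M).
Proof.
elim: M => [|a M IHM] /=; first by rewrite word_nil.
rewrite IHM /append -cat_rcons -word_rcons; move: (rcons _ _) => u.
elim: (a.-1) u => [|n IHn] u; first by rewrite cats0.
by rewrite iterSr [nseq _ _]/= -cat_rcons -IHn word_rcons.
Qed.

Lemma wstar_nil : wstar [::] = 1.
Proof.
rewrite -[[::]]/(drop 0 [::]) wstar_drop // -[verts _ _ _]/[::].
by rewrite (lin_sum_nil word_nil).
Qed.

Lemma sign_mulr (R : pzRingType) n (f : R) : (-1) ^+ n * f = if odd n then - f else f.
Proof. by rewrite -signr_odd mulr_sign. Qed.

(** The vanishing alternating sum of cuts is solved for its uncut term. *)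
Lemma wstar_rec a M : is_index (a :: M) ->
  (wstar (a :: M) : Hsh) = \sum_(b < (size M).+1) (-1) ^+ b *
    (block_word (append lx) (append ly) (a :: take b M) * (wstar (drop b M) : Hsh)).
Proof.
move=> posM.
have cuts := @alternating_cuts _ _ _ word let_ sh word_span word_nil word_rcons shC
  shDl shZl sh_nil sh_rcons lx ly (a :: M) posM isT.
pose F b : Hsh :=
  sh (word (block_letters lx ly (take b (a :: M)))) (wstar (drop b (a :: M))).
have {}cuts : \sum_(b < (size M).+2) (-1) ^+ b * F b = 0.
  rewrite -[RHS]cuts; apply: eq_bigr => b _; rewrite sign_mulr /F wstar_drop //.
  by rewrite -ltnS.
have F0 : F 0%N = wstar (a :: M).
  by rewrite /F take0 drop0 -[block_letters _ _ _]/[::] word_nil; exact: sh1.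
move: cuts; rewrite big_ord_recl expr0 mul1r [F ord0]F0 => /eqP.
rewrite addr_eq0 => /eqP ->; rewrite -sumrN; apply: eq_bigr => b _.
by rewrite /bump exprS mulN1r mulNr opprK block_wordE.
Qed.

(** * Back to the statement *)

Lemma in_H1D f g : in_H1 f -> in_H1 g -> in_H1 (f + g).
Proof.
move=> [c [h ->]] [c' [h' ->]]; exists (c + c'), (h + h').
by rewrite raddfD (@mulrDr H) (@addrACA H).
Qed.

Lemma in_H1N f : in_H1 f -> in_H1 (- f).
Proof.
move=> [c [h ->]]; exists (- c), (- h).
by rewrite raddfN (@mulrN H) (@opprD H).
Qed.

Lemma in_H1_0 : in_H1 0.
Proof. by exists 0, 0; rewrite raddf0 (@mulr0 H) (@addr0 H). Qed.

Lemma in_H1_nat n f : in_H1 f -> in_H1 (n%:R *: f).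
Proof.
move=> Hf; rewrite (scaler_nat n f); elim: n => [|n IHn]; first exact: in_H1_0.
by rewrite (@mulrS H); exact: in_H1D.
Qed.

Lemma in_H1_sign n f : in_H1 f -> in_H1 ((-1) ^+ n *: f).
Proof.
rewrite -signr_odd; case: odd => Hf; first by rewrite (@scaleN1r rat H); exact: in_H1N.
by rewrite (@scale1r rat H).
Qed.

Lemma in_H1_sum (I : Type) (r : seq I) (P : pred I) (F : I -> H) :
  (forall i, P i -> in_H1 (F i)) -> in_H1 (\sum_(i <- r | P i) F i).
Proof. by move=> HF; elim/big_ind: _ => //; [exact: in_H1_0 | exact: in_H1D]. Qed.

Lemma in_H1_word s : in_H1 (word (ly :: s)).
Proof.
exists 0, (word s); rewrite raddf0 (@add0r H).
by rewrite /let_ wordM.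
Qed.

(** The first element of a linear extension is minimal, hence the bottom of a chain and labelled y;
    otherwise its predecessor in the chain would have to come earlier. *)
Lemma in_H1_wstar k : in_H1 (wstar k).
Proof.
rewrite -[k]drop0 wstar_drop // /lin_sum big_seq_cond; apply: in_H1_sum.
case=> [|p s] /andP[]; rewrite mem_permutations => perm_s.
  by move=> _; exists 1, 0; rewrite word_nil (@mulr0 H) (@addr0 H).
rewrite /= => /andP[/allP min_p _].
suff -> : zlab lx ly p = ly by exact: in_H1_word.
have : p \in verts k 0 (size k) by rewrite -(perm_mem perm_s) mem_head.
case: p perm_s min_p => i [|m] perm_s min_p //; rewrite mem_verts /= => Hp.
have : (i, m) \in (i, m.+1) :: s by rewrite (perm_mem perm_s) mem_verts /=; lia.
rewrite inE xpair_eqE (ltn_eqF (leqnn _)) andbF => /min_p.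
by rewrite /zlink /= !eqxx.
Qed.

Lemma in_H1_wCSF k : in_H1 (wCSF k).
Proof.
apply: in_H1D; last exact/in_H1N/in_H1_nat/in_H1_wstar.
by do 2![apply: in_H1_sum => ? _]; exact: in_H1_wstar.
Qed.

Lemma in_H1_rhs k n : in_H1 (cst (wCSF k) n + (-1) ^+ (sumn k).+1 *: shift_sum wCSF k n).
Proof.
apply: in_H1D; first by rewrite /cst; case: eqP => _; [exact: in_H1_wCSF|exact: in_H1_0].
by apply/in_H1_sign/in_H1_sum => l _; apply/in_H1_nat/in_H1_wCSF.
Qed.

(** * Coefficients of the binomial shift *)

(** Peeling off the first part matches the recursion of [tshift], unlike the bounded tuples of
    [sum_tl]. *)
Fixpoint weak_compositions s n : seq (seq nat) :=
  if s is s'.+1 then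
    [seq j :: l | j <- iota 0 n.+1, l <- weak_compositions s' (n - j)%N]
  else if n == 0%N then [:: [::]] else [::].

Lemma mem_weak_compositions s n l :
  (l \in weak_compositions s n) = (size l == s) && (sumn l == n).
Proof.
elim: s n l => [|s IHs] n l; first by case: n => [|n]; case: l => [|a l]; rewrite ?inE.
apply/allpairsPdep/andP => [[j [l' [jn]]]|[]].
  rewrite IHs => /andP[/eqP sl' /eqP suml'] ->; move: jn; rewrite mem_iota /= sl' suml'.
  by move=> jn; split=> //; apply/eqP; lia.
case: l => [//|j l]; rewrite eqSS => sl /eqP /= suml.
exists j, l; split=> //; last by rewrite IHs sl -suml addKn eqxx.
by rewrite -[X in _ \in X]/(iota 0 n.+1) mem_iota -suml ltnS leq_addr.
Qed.

Lemma uniq_weak_compositions s n : uniq (weak_compositions s n).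
Proof.
elim: s n => [|s IHs] n; first by rewrite /=; case: eqP.
apply: allpairs_uniq_dep => [|j _|]; [exact: iota_uniq | exact: IHs |].
by move=> [j l] [j' l'] _ _ /= [-> ->].
Qed.

Lemma sum_tlE s f n : sum_tl s f n = \sum_(l <- weak_compositions s n) f l.
Proof.
pose tup (l : s.-tuple 'I_n.+1) := map val l.
transitivity (\sum_(l <- map tup [seq l <- index_enum (s.-tuple 'I_n.+1) |
    sumn (map val (l : s.-tuple 'I_n.+1)) == n]) f l).
  by rewrite big_map big_filter.
apply: perm_big; apply: uniq_perm; last 1 first.
- move=> l; rewrite mem_weak_compositions; apply/mapP/andP => [[u]|[/eqP sl /eqP suml]].
    by rewrite mem_filter => /andP[sumu _] ->; rewrite size_map size_tuple.
  have size_l : size (map (@inord n) l) == s by rewrite size_map sl.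
  have val_l : map val (map (@inord n) l) = l.
    rewrite -map_comp -[RHS]map_id; apply/eq_in_map => j jl /=.
    apply: inordK; rewrite ltnS -suml; move: jl {size_l sl suml}.
    elim: l => //= a l IHl; rewrite inE => /orP[/eqP ->|/IHl le_j]; first exact: leq_addr.
    exact: leq_trans le_j (leq_addl _ _).
  exists (Tuple size_l); last by rewrite /tup /= val_l.
  by rewrite mem_filter mem_index_enum andbT /= val_l suml.
- rewrite map_inj_uniq ?filter_uniq ?index_enum_uniq // => u u' /= eq_uu'.
  by apply: val_inj; apply: (inj_map val_inj).
- exact: uniq_weak_compositions.
Qed.

Lemma coefs_tshift (A : comNzRingType) (f : seq nat -> A) k n :
  coefs (tshift f k) n =
    \sum_(l <- weak_compositions (size k) n) f (add_index k l) *+ binom_index k l.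
Proof.
elim: k f n => [|a k IHk] f n.
  case: n => [|n]; last by rewrite big_nil.
  by rewrite big_seq1 /binom_index /add_index /= big_nil mulr1n.
rewrite -[weak_compositions _ _]/[seq j :: l | j <- iota 0 n.+1,
  l <- weak_compositions (size k) (n - j)%N].
rewrite big_allpairs_dep -[iota 0 n.+1]/(index_iota 0 n.+1) big_mkord /=.
apply: eq_bigr => j _; rewrite coefsMn IHk -sumrMnl; apply: eq_bigr => l _.
by rewrite /add_index /binom_index /= big_cons mulnC mulrnA.
Qed.

Lemma sum_Hsh (I : Type) (r : seq I) (P : pred I) (F : I -> H) :
  \sum_(i <- r | P i) (F i : Hsh) = \sum_(i <- r | P i) F i.
Proof. by []. Qed.

Lemma mulrn_Hsh (f : H) n : (f : Hsh) *+ n = f *+ n.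
Proof. by []. Qed.

Lemma sign_Hsh n (f : Hsh) : (-1) ^+ n * f = ((-1) ^+ n : rat) *: (f : H).
Proof.
rewrite sign_mulr -signr_odd; case: odd; first by rewrite (@scaleN1r rat H).
by rewrite (@scale1r rat H).
Qed.

Lemma shift_sumE (f : seq nat -> H) k n :
  shift_sum f k n = coefs (tshift (f : seq nat -> Hsh) (rev k)) n.
Proof.
rewrite -tshift_rev coefs_tshift /shift_sum sum_tlE sum_Hsh.
by apply: eq_bigr => l _; rewrite (scaler_nat (binom_index k l)) mulrn_Hsh.
Qed.

Local Notation wH := (wstar : seq nat -> Hsh).

Lemma wstarSE k n : wstarS k n = coefs (wS wH k) n.
Proof.
rewrite /wstarS /wS coefs_sum sum_Hsh; apply: eq_bigr => i _.
rewrite coefs_sign sign_Hsh coefsCM -shift_sumE; congr (_ *: _).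
rewrite /sht big_ord_recl subn0 big1 => [|j _]; last first.
  by rewrite /cst /=; exact: (@mul0r Hsh).
by rewrite (@addr0 H).
Qed.

Lemma csf_indexE k i j : (i < size k)%N ->
  csf_index k i j = j.+1 :: rcons (behead (rot i k)) (head 0%N (rot i k) - j)%N.
Proof.
move=> lti; rewrite /csf_index /rot (drop_nth 0%N lti) /= -cats1 -catA.
by [].
Qed.

Lemma csf_termsE (f : seq nat -> Hsh) c : csf_terms f c =
  \sum_(j < (head 0%N c).-1) f (j.+1 :: rcons (behead c) (head 0%N c - j)%N).
Proof. by case: c => [|a m] //=; rewrite big_ord0. Qed.

Lemma head_rot k i : (i < size k)%N -> head 0%N (rot i k) = nth 0%N k i.
Proof. by move=> lti; rewrite /rot (drop_nth 0%N lti). Qed.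

Lemma wCSFE k : wCSF k = csf wH k.
Proof.
rewrite /wCSF /csf; congr (_ - _); last first.
  by rewrite (scaler_nat (sumn k)).
rewrite sum_Hsh; apply: eq_bigr => i _; rewrite csf_termsE sum_Hsh head_rot //.
by apply: eq_bigr => j _; rewrite csf_indexE // head_rot.
Qed.

Lemma wCSFSE k n : wCSFS k n = coefs (csfS wH k) n.
Proof.
rewrite /wCSFS /csfS.
have -> : (sumn k)%:R *: wstarS [:: (sumn k).+1] n =
    coefs (wS wH [:: (sumn k).+1] *+ sumn k) n.
  by rewrite coefsMn -wstarSE (scaler_nat (sumn k)).
rewrite -[RHS]/(coefs (\sum_(i < size k) csf_termsS wH (rot i k)) n
   - coefs (wS wH [:: (sumn k).+1] *+ sumn k) n).
congr (_ - _); rewrite coefs_sum sum_Hsh -(@sumrB H); apply: eq_bigr => i _.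
have lti := ltn_ord i.
case rotik: (rot i k) => [|a m].
  have sk : size k = 0%N by rewrite -(size_rot i k) rotik.
  by move: {+}lti; rewrite [X in (_ < X)%N]sk.
have nth_i : nth 0%N k i = a by rewrite -head_rot // rotik.
rewrite /csf_termsS -[RHS]/(coefs (\sum_(j < a.-1) wS wH (j.+1 :: rcons m (a - j)%N)) n
  - coefs (fps_sum (fun j => wS wH (j.+1 :: rcons m a))) n).
congr (_ - _).
  rewrite nth_i coefs_sum sum_Hsh; apply: eq_bigr => j _.
  by rewrite wstarSE csf_indexE // rotik.
rewrite /sum_t /= sum_Hsh; apply: eq_bigr => j _; rewrite wstarSE.
by rewrite -[_ ++ _]/(rot i.+1 k) rotS // rotik rot1_cons.
Qed.

Theorem theorem2p7 (k : seq nat) (k_index : is_index k) (k_neq0 : k != [::]) :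
  forall n : nat, in_H1 (wCSFS k n) /\
    wCSFS k n = cst (wCSF k) n + (-1) ^+ (sumn k).+1 *: shift_sum wCSF k n.
Proof.
move=> n.
(* Membership is inherited from the right-hand side, a linear combination of star words. *)
suff main : wCSFS k n = cst (wCSF k) n + (-1) ^+ (sumn k).+1 *: shift_sum wCSF k n.
  by split=> //; rewrite main; exact: in_H1_rhs.
rewrite wCSFSE (cyclic_sum_formula (append_mul lx lx) (append_mul ly lx)
  (append_mul ly ly) wstar_nil wstar_rec k_index k_neq0).
rewrite coefsD coefs_sign sign_Hsh shift_sumE /= /cst wCSFE; congr (_ + _ *: _).
by rewrite (@eq_tshift_fun Hsh _ (wCSF : seq nat -> Hsh)) // => K; rewrite wCSFE.
Qed.
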